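(* Let $m\ge2$, $N\ge1$, and let $T_i(\kappa)$, $1\le i\le N$, be the Dunkl operators of $G(m,1,N)$ with parameters $\kappa=(\kappa_0,\kappa_1,\dots,\kappa_{m-1})$. Suppose $f,g$ are symmetric polynomials in $y=(y_1,\dots,y_N)=(x_1^m,\dots,x_N^m)$. Then $$f(T(\kappa))\,a_\delta(y)\,g(y)=a_\delta(y)\,f(T(\kappa'))\,g(y),$$ where $a_\delta(y)=\prod_{1\le i<j\le N}(y_i-y_j)$ and $\kappa'=(\kappa_0+1,\kappa_1,\dots,\kappa_{m-1})$.
   Context: $\eta=e^{2\pi\mathrm{i}/m}$, $x=(x_1,\dots,x_N)$. $w\in S_N$ acts on polynomials by $w(x^\alpha)=x^{w\alpha}$, $(w\alpha)_i=\alpha_{w^{-1}(i)}$; $(i,j)$ is the transposition; $\tau_i$ acts by $\tau_ix^\alpha=\eta^{\alpha_i}x^\alpha$. For parameters $\kappa=(\kappa_0,\dots,\kappa_{m-1})$, $$T_i(\kappa)=\frac{\partial}{\partial x_i}+\kappa_0\sum_{j\ne i}\sum_{s=0}^{m-1}\frac{1-\tau_i^{-s}(i,j)\tau_i^s}{x_i-\eta^sx_j}+\sum_{t=1}^{m-1}\kappa_t\sum_{s=0}^{m-1}\frac{\eta^{-st}\tau_i^s}{x_i}$$ on polynomials in $x$ (divisions after applying numerators). The $T_i(\kappa)$ commute. $f(T(\kappa))$ denotes the operator obtained from $f$, viewed as a polynomial in $x$, by substituting $T_i(\kappa)$ for $x_i$, i.e. $y_i$ is replaced by $T_i(\kappa)^m$.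 Both sides are obtained by applying the operators to the indicated polynomials. *)

(* Defs.v *)
From mathcomp Require Import all_boot all_order all_algebra all_fingroup.
From mathcomp Require Import complex mpoly.
From mathcomp Require Import boolp classical_sets reals trigo.
From mathcomp Require Import ring lra.

Set Implicit Arguments.
Unset Strict Implicit.
Unset Printing Implicit Defensive.

Import Order.TTheory GRing.Theory Num.Theory.
Local Open Scope ring_scope.

Definition eta (R : realType) (m : nat) : R[i]%C :=
  (cos (2 * pi / m%:R) +i* sin (2 * pi / m%:R))%C.

(* The polynomial r with r * q = p. For q != 0 there is at most one (mquotK);
   the default 0 is never used in the Dunkl operators, see
   reflection_quotient and cyclic_quotient below. *)
Definition mquot (K : idomainType) (n : nat) (p q : {mpoly K[n]}) :
  {mpoly K[n]} := xget 0 [set r | r * q = p]%classic.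

Lemma mquotK (K : idomainType) (n : nat) (r q : {mpoly K[n]}) :
  q != 0 -> mquot (r * q) q = r.
Proof.
move=> q0; rewrite /mquot; case: xgetP => [r' _ /= /(mulIf q0)//|/(_ r)].
by move=> /(_ erefl).
Qed.

Lemma mquot_mul (K : idomainType) (n : nat) (p q : {mpoly K[n]}) :
  (exists r, p = r * q) -> mquot p q * q = p.
Proof.
case=> r ->; rewrite /mquot; case: xgetP => [r' _ //|/(_ r)].
by move=> /(_ erefl).
Qed.

Section Dunkl.
Context {R : realType} {m N : nat}.
Implicit Types (kappa : m.-tuple R[i]%C) (i j : 'I_N) (p f : {mpoly R[i]%C[N]}).

(* tau s i is the s-th power of tau_i, for s in Z. *)
Definition tau (s : int) i p : {mpoly R[i]%C[N]} :=
  \sum_(a <- msupp p) (eta R m ^ (s * (a i)%:Z) * p@_a) *: 'X_[a].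

(* msym w sends x_k to x_(w k), i.e. x^a to x^(w a) with
   (w a)_k = a_(w^-1 k). *)
Definition reflection (s : nat) i j p : {mpoly R[i]%C[N]} :=
  tau (- s%:Z) i (msym (tperm i j) (tau s%:Z i p)).

(* The sum over s in the last term is divided by x_i as a whole: its individual
   terms are in general not divisible by x_i. *)
Definition dunkl kappa i p : {mpoly R[i]%C[N]} :=
  mderiv i p
  + kappa`_0 *: (\sum_(j < N | j != i) \sum_(s < m)
      mquot (p - reflection s i j p) ('X_i - eta R m ^+ s *: 'X_j))
  + \sum_(1 <= t < m) kappa`_t *:
      mquot (\sum_(s < m) eta R m ^ (- (s * t)%N%:Z) *: tau s%:Z i p) 'X_i.

(* f(T_1, ..., T_N) applied to p; the operators dunkl kappa i commute, and the
   monomial of exponent a is read as T_1^(a_1) o ... o T_N^(a_N). *)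
Definition dunkl_subst kappa f p : {mpoly R[i]%C[N]} :=
  \sum_(a <- msupp f)
     f@_a *: foldr (fun i => iter (a i) (dunkl kappa i)) p (enum 'I_N).

(* h(y) as a polynomial in x, for y_i = x_i^m. *)
Definition in_y f : {mpoly R[i]%C[N]} :=
  f \mPo [tuple ('X_k : {mpoly R[i]%C[N]}) ^+ m | k < N].

Definition a_delta : {mpoly R[i]%C[N]} :=
  \prod_(i < N) \prod_(j < N | (i < j)%N) ('X_i - 'X_j).

Definition shift0 kappa : m.-tuple R[i]%C :=
  [tuple kappa`_t + (t == 0%N :> nat)%:R | t < m].

End Dunkl.

Arguments tau {R} m {N}.
Arguments reflection {R} m {N}.
Arguments dunkl {R m N}.
Arguments dunkl_subst {R m N}.
Arguments in_y {R} m {N}.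
Arguments a_delta : clear implicits.
Arguments shift0 {R m}.

Lemma cis_exp (R : realType) (x : R) (k : nat) :
  ((cos x +i* sin x) ^+ k = cos (k%:R * x) +i* sin (k%:R * x))%C.
Proof.
elim: k => [|k IH]; first by rewrite expr0 mul0r cos0 sin0.
rewrite exprS IH -natr1 mulrDl mul1r (addrC _ x) cosD sinD.
by congr Complex; ring.
Qed.

Lemma eta_prim (R : realType) (m : nat) :
  (0 < m)%N -> m.-primitive_root (eta R m).
Proof.
move=> m0; have m0R : 0 < m%:R :> R by rewrite ltr0n.
have etam : eta R m ^+ m = 1.
  rewrite cis_exp mulrCA divff ?gt_eqF// mulr1 mulr_natl -[X in cos X]add0r cosD2pi.
  by rewrite -[X in sin X]add0r sinD2pi cos0 sin0.
have [d dprim ddvd] := prim_order_exists m0 etam.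
suff dm : d = m by rewrite dm in dprim.
have d0 := prim_order_gt0 dprim.
apply/eqP; rewrite eqn_leq (dvdn_leq m0 ddvd) /= leqNgt; apply/negP => dm.
have := prim_expr_order dprim; rewrite cis_exp => -[cosE _].
set y : R := pi * (d%:R / m%:R).
have yE : d%:R * (2 * pi / m%:R) = y *+ 2.
  by rewrite /y mulr2n -mulr_natl; rewrite !mulrA mulrAC -!mulrA; ring.
move: cosE; rewrite yE cos_mulr2n => cosE.
have sy : 0 < sin y.
  apply: sin_gt0_pi; rewrite /y mulr_gt0 ?pi_gt0 ?divr_gt0 ?ltr0n//=.
  by rewrite gtr_pMr ?pi_gt0// ltr_pdivrMr// mul1r ltr_nat.
have := sin2cos2 y; have := exprn_gt0 2 sy.
move: cosE; move: (cos y ^+ 2) (sin y ^+ 2) => u v.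
move=> *; lra.
Qed.

Lemma eta_neq0 (R : realType) (m : nat) : (0 < m)%N -> eta R m != 0.
Proof. by move=> m0; rewrite (prim_root_eq0 (eta_prim R m0)) -lt0n. Qed.


Lemma tau_comp (R : realType) (m N : nat) (s : int) (i : 'I_N)
    (p : {mpoly R[i]%C[N]}) :
  tau m s i p =
  p \mPo [tuple (if k == i then eta R m ^ s else 1) *: 'X_k | k < N].
Proof.
rewrite comp_mpolyE; apply: eq_bigr => a _.
under [in RHS]eq_bigr do rewrite tnth_mktuple exprZn.
rewrite scaler_prod -mpolyXE_id scalerA mulrC; congr (_ * _ *: _).
rewrite (bigD1 i)//= eqxx big1 ?mulr1 => [|k /negbTE->]; last by rewrite expr1n.
by rewrite exprnP exprz_exp.
Qed.

Lemma reflection_quotient (R : realType) (m N : nat) (s : nat) (i j : 'I_N)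
    (p : {mpoly R[i]%C[N]}) (q := 'X_i - eta R m ^+ s *: 'X_j) :
  (0 < m)%N -> j != i ->
  mquot (p - reflection m s i j p) q * q = p - reflection m s i j p.
Proof.
move=> m0 ji; apply: mquot_mul.
pose P (p : {mpoly R[i]%C[N]}) := exists r, p - reflection m s i j p = r * q.
have reflE p' : reflection m s i j p' =
    (msym (tperm i j) (p' \mPo [tuple (if k == i then eta R m ^ s%:Z else 1) *: 'X_k | k < N]))
    \mPo [tuple (if k == i then eta R m ^ (- s%:Z) else 1) *: 'X_k | k < N].
  by rewrite /reflection !tau_comp.
have PM p1 p2 : P p1 -> P p2 -> P (p1 * p2).
  case=> r1 e1 [r2 e2]; exists (r1 * p2 + reflection m s i j p1 * r2).
  have -> : reflection m s i j (p1 * p2) =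
            reflection m s i j p1 * reflection m s i j p2.
    by rewrite !reflE !(rmorphM, msymM).
  rewrite mulrDl mulrAC -e1 -mulrA -e2.
  by rewrite mulrBl mulrBr addrA subrK.
have P1 : P 1 by exists 0; rewrite reflE rmorph1 msym1 rmorph1 subrr mul0r.
have e0 := eta_neq0 R m0.
have PX k : P 'X_k.
  rewrite /P reflE comp_mpolyXU -tnth_nth tnth_mktuple msymZ linearZ/=.
  have -> : msym (tperm i j) ('X_k : {mpoly R[i]%C[N]}) = 'X_(tperm i j k).
    by rewrite /msym mmapX mmap1U.
  rewrite comp_mpolyXU -tnth_nth tnth_mktuple scalerA.
  have [->|ki] := eqVneq k i.
    by exists 1; rewrite tpermL (negbTE ji) mulr1 mul1r.
  have [->|kj] := eqVneq k j.
    exists (- (eta R m ^- s)%:MP); rewrite tpermR eqxx mul1r -exprnN.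
    rewrite mulNr mul_mpolyC /q scalerBr opprB scalerA mulVf ?scale1r//.
    by rewrite expf_neq0.
  exists 0; have -> : tperm i j k = k by rewrite tpermD// eq_sym.
  by rewrite (negbTE ki) mulr1 scale1r subrr mul0r.
rewrite -/(P p); elim/mpolyind: p => [|c a p _ _ [r e]].
  by exists 0; rewrite reflE raddf0 msym0 raddf0 subrr mul0r.
have [r' e'] : P 'X_[a].
  rewrite mpolyXE_id; apply: (big_ind P); [exact: P1 | exact: PM | move=> k _].
  elim: (a k) => [|n IH]; first by rewrite expr0; exact: P1.
  by rewrite exprS; apply: PM; [exact: PX | exact: IH].
exists (c *: r' + r); rewrite mulrDl -e -scalerAl -e' !reflE.
rewrite comp_mpolyD comp_mpolyZ msymD msymZ comp_mpolyD comp_mpolyZ.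
by rewrite scalerBr opprD addrACA.
Qed.

Lemma cyclic_quotient (R : realType) (m N : nat) (t : nat) (i : 'I_N)
    (p : {mpoly R[i]%C[N]})
    (q := \sum_(s < m) eta R m ^ (- (s * t)%N%:Z) *: tau m s%:Z i p) :
  (0 < t < m)%N -> mquot q 'X_i * 'X_i = q.
Proof.
case/andP=> t0 tm; have m0 := ltn_trans t0 tm; apply: mquot_mul.
have e0 := eta_neq0 R m0; have eprim := eta_prim R m0.
have -> : q = \sum_(a <- msupp p)
    (p@_a * \sum_(s < m) (eta R m ^ (- t%:Z + (a i)%:Z)) ^+ s) *: 'X_[a].
  rewrite /q; under eq_bigr do rewrite scaler_sumr.
  rewrite exchange_big; apply: eq_bigr => a _ /=.
  rewrite mulr_sumr scaler_suml; apply: eq_bigr => s _.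
  rewrite scalerA mulrA -expfzDr// mulrC; congr (_ * _ *: _).
  by rewrite exprnP exprz_exp; congr (_ ^ _); rewrite PoszM; ring.
apply: (big_ind (fun q => exists r, q = r * 'X_i)).
- by exists 0; rewrite mul0r.
- by move=> _ _ [r1 ->] [r2 ->]; exists (r1 + r2); rewrite mulrDl.
move=> a _; case: (posnP (a i)) => ai; last first.
  set c := _ * _; exists (c *: 'X_[a - U_(i)]); rewrite -scalerAl -mpolyXD submK//.
  by apply/mnm_lepP => k; rewrite mnm1E; case: eqP => // <-.
exists 0; rewrite mul0r ai addr0; set z := eta R m ^ _.
have z1 : z != 1.
  by rewrite /z -exprnN invr_eq1 -(prim_order_dvd eprim) gtnNdvd.
have : (z - 1) * (\sum_(s < m) z ^+ s) = 0.
  rewrite -subrX1 /z -exprnN exprVn exprAC (prim_expr_order eprim).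
  by rewrite (expr1n _ t) invr1 subrr.
by move/eqP; rewrite mulf_eq0 subr_eq0 (negbTE z1) => /eqP->; rewrite mulr0 scale0r.
Qed.

(* Main.v *)
(* On polynomials in y, the power T_i^m acts as m^m A_i with
   A_i = (U_i + c_1) ... (U_i + c_(m-1)) D_i, where D_i is the Dunkl operator of
   S_N in the variables y with parameter kappa_0, U_i = D_i y_i, and
   c_r = r/m - 1 + kappa_r.  So only kappa_0 matters, and the claim becomes
   f(A(k)) a_delta g = a_delta f(A(k + 1)) g.

   Call a pair (O, O') transferable if O (a_delta g) = a_delta O' g for symmetric
   g.  Transferable pairs form an algebra containing the multiplications by
   symmetric polynomials and, by a direct computation, the Laplacian sum_i D_i^2.
   Iterated commutators of the Laplacian with power sums of y produce
   sum_i D_i, X = sum_i D_i y_i D_i and Xs = sum_i y_i D_i y_i.  The operator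
   2 [Xs, X] + k sum_(a <> b) s_ab commutes with every U_i and its commutator with
   D_i is 12 U_i D_i; hence it raises sum_i q(U_i) D_i to sum_i U_i q(U_i) D_i,
   and all of these are transferable.  Finally [sum_j U_j A_j, A_i] = - A_i^2, so
   that commutators produce all power sums of the A_i, and power sums generate the
   symmetric polynomials. *)
From HB Require Import structures.
From Stdlib Require Ncring Ncring_tac.
Require Import Defs.
From mathcomp Require Import all_boot all_order all_algebra all_fingroup.
From mathcomp Require Import complex mpoly.
From mathcomp Require Import boolp reals.
From mathcomp Require Import ring zify.

Set Implicit Arguments.
Unset Strict Implicit.
Unset Printing Implicit Defensive.

Import Order.Theory GRing.Theory Num.Theory.
Local Open Scope ring_scope.

(** * The rational Cherednik algebra of S_N *)

Section NcRing.
Variable E : pzRingType.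

(** Makes the noncommutative normalization of [Ncring] available on [E]; it settles the identities
    that hold in every ring. *)
#[local] Instance ncring_ops :
  @Ncring.Ring_ops E 0 1 +%R *%R (fun x y => x - y) -%R eq := {}.

#[local] Instance ncring : Ncring.Ring (Ro := ncring_ops).
Proof.
split; try exact _.
- exact: (@add0r E).
- exact: (@addrC E).
- exact: (@addrA E).
- exact: (@mul1r E).
- exact: (@mulr1 E).
- exact: (@mulrA E).
- exact: (@mulrDl E).
- move=> x y z; exact: (@mulrDr E).
- by [].
- exact: (@subrr E).
Qed.

Definition lie (a b : E) := a * b - b * a.

Ltac ncr := rewrite /lie; Ncring_tac.non_commutative_ring.

Lemma lie_suml (I : finType) (P : pred I) (F : I -> E) b :
  lie (\sum_(i | P i) F i) b = \sum_(i | P i) lie (F i) b.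
Proof. by rewrite /lie mulr_suml mulr_sumr sumrB. Qed.

Lemma lie_sumr (I : finType) (P : pred I) (F : I -> E) b :
  lie b (\sum_(i | P i) F i) = \sum_(i | P i) lie b (F i).
Proof. by rewrite /lie mulr_suml mulr_sumr sumrB. Qed.

Lemma lieMr a b c : lie a (b * c) = lie a b * c + b * lie a c.
Proof. ncr. Qed.

Lemma lieMl a b c : lie (a * b) c = a * lie b c + lie a c * b.
Proof. ncr. Qed.

Lemma jacobi a b c : lie (lie a b) c = lie a (lie b c) - lie b (lie a c).
Proof. ncr. Qed.

Lemma lieN a b : lie a b = - lie b a.
Proof. ncr. Qed.

Context {I : finType}.

(* [t i j] stands for the parameter times the transposition of i and j, so that
   no scalars occur in the relations; [t i i] is irrelevant. *)
Record cherednik_rel (D y : I -> E) (t : I -> I -> E) : Prop := {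
  chyy : forall i j, y i * y j = y j * y i;
  chtC : forall i j, t i j = t j i;
  chDy : forall i j, i != j -> D i * y j = y j * D i - t i j;
  chDyi : forall i, D i * y i = y i * D i + 1 + \sum_(j | j != i) t i j;
  chtD : forall i j, i != j -> t i j * D i = D j * t i j;
  chtDl : forall i j l, i != j -> l != i -> l != j -> t i j * D l = D l * t i j;
  chty : forall i j, i != j -> t i j * y i = y j * t i j;
  chtyl : forall i j l, i != j -> l != i -> l != j -> t i j * y l = y l * t i j;
  chtt : forall i j l, i != j -> l != i -> l != j ->
    t i l * t i j = t j l * t i l }.

Record cherednik (D y : I -> E) (t : I -> I -> E) : Prop := {
  chrel :> cherednik_rel D y t;
  chDD : forall i j, D i * D j = D j * D i }.

(* An operator on polynomials that commutes with all y_l is determined by its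
   value at 1; this yields the commutativity of the D_i. *)
Lemma lie_DD_y D y t : cherednik_rel D y t ->
  forall i j l, lie (lie (D i) (D j)) (y l) = 0.
Proof.
move=> C.
have Dy i j : i != j -> lie (D i) (y j) = - t i j.
  by move=> ij; rewrite /lie (chDy C ij); ncr.
have Dyi i : lie (D i) (y i) = 1 + \sum_(j | j != i) t i j.
  by rewrite /lie (chDyi C i); ncr.
have tDl i j l : i != j -> l != i -> l != j -> lie (D l) (t i j) = 0.
  by move=> ij li lj; rewrite /lie (chtDl C) ?subrr.
have H i j : i != j -> lie (lie (D i) (D j)) (y j) = 0.
  move=> ij; have ji : j != i by rewrite eq_sym.
  rewrite jacobi Dyi Dy // (bigD1 i) //=.
  have -> : lie (D i) (1 + (t j i + \sum_(l | (l != j) && (l != i)) t j l)) = lie (D i) (t j i).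
    transitivity (lie (D i) (t j i) + lie (D i) (\sum_(l | (l != j) && (l != i)) t j l)).
      by ncr.
    by rewrite lie_sumr big1 ?addr0 // => l /andP[lj li]; rewrite tDl // 1?eq_sym.
  (* What remains is the commutator of D_i + D_j with t_ij, and t_ij exchanges D_i and D_j. *)
  have e1 := chtD C ij; have := chtD C ji; rewrite (chtC C j i) => e2.
  transitivity (D i * t i j - t i j * D i + D j * t i j - t i j * D j); first by ncr.
  by rewrite e1 e2; ncr.
move=> i j l; have [->|ij] := eqVneq i j; first by ncr.
have ji : j != i by rewrite eq_sym.
have [->|lj] := eqVneq l j; first exact: H.
have [->|li] := eqVneq l i.
  transitivity (- lie (lie (D j) (D i)) (y i)); first by ncr.
  by rewrite H ?oppr0.
rewrite jacobi !Dy 1?eq_sym //.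
transitivity (lie (D j) (t i l) - lie (D i) (t j l)); first by ncr.
by rewrite !tDl ?subrr // 1?eq_sym.
Qed.

(** These are the A_i of the overview when [cs] lists the c_r. An arbitrary list allows the factors
    to be added one at a time. *)
Definition dunkl_word (D y : I -> E) (cs : seq E) i :=
  (\prod_(c <- cs) (D i * y i + c)) * D i.

(** * Commutators with the Laplacian, with X and with Xs *)

Section Derivations.
Context {D y : I -> E} {t : I -> I -> E} (C : cherednik D y t).
Let J i := \sum_(j | j != i) t i j.

Lemma t_Dr i j : i != j -> t i j * D j = D i * t i j.
Proof. by move=> ij; rewrite (chtC C) (chtD C) // eq_sym. Qed.

Lemma t_yr i j : i != j -> t i j * y j = y i * t i j.
Proof. by move=> ij; rewrite (chtC C) (chty C) // eq_sym. Qed.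

Lemma lie_Dy_neq i j : i != j -> lie (D i) (y j) = - t i j.
Proof. by move=> ij; rewrite /lie (chDy C ij); ncr. Qed.

Lemma lie_Dyi i : lie (D i) (y i) = 1 + J i.
Proof. by rewrite /lie (chDyi C) -/(J i); ncr. Qed.

(** The commutator [D_i^2, y_i] contributes D_i J_i + J_i D_i besides 2 D_i, and the [D_j^2, y_i]
    with j different from i cancel exactly this. *)
Lemma lie_laplacian_y i : lie (\sum_j D j * D j) (y i) = D i *+ 2.
Proof.
rewrite lie_suml (bigD1 i) //= lieMl lie_Dyi.
rewrite (eq_bigr (fun j => - (D i * t i j + t i j * D i))); last first.
  move=> j ji; have ij : i != j by rewrite eq_sym.
  by rewrite lieMl lie_Dy_neq // (chtC C j i) mulrN mulNr -opprD t_Dr // addrC -(chtD C) // chtC.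
rewrite sumrN big_split /= -mulr_sumr -mulr_suml -/(J i) mulr2n.
ncr.
Qed.

Lemma lie_laplacian_D i : lie (\sum_j D j * D j) (D i) = 0.
Proof.
by rewrite lie_suml big1 // => j _; rewrite lieMl /lie (chDD C j i) subrr mul0r mulr0 addr0.
Qed.

Lemma sum_swap (F G : I -> I -> E) : (forall i j, i != j -> F i j = G j i) ->
  \sum_i \sum_(j | j != i) F i j = \sum_i \sum_(j | j != i) G i j.
Proof.
move=> FG; rewrite (exchange_big_dep xpredT) //=; apply: eq_bigr => i _.
by apply: eq_big => j; rewrite 1?eq_sym // => /FG.
Qed.

Lemma sum_J_y : \sum_i J i * y i = \sum_i y i * J i.
Proof.
under eq_bigr do rewrite /J mulr_suml; under [RHS]eq_bigr do rewrite /J mulr_sumr.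
by apply: sum_swap => i j ij; rewrite (chty C) // (chtC C).
Qed.

Lemma sum_J_D : \sum_i J i * D i = \sum_i D i * J i.
Proof.
under eq_bigr do rewrite /J mulr_suml; under [RHS]eq_bigr do rewrite /J mulr_sumr.
by apply: sum_swap => i j ij; rewrite (chtD C) // (chtC C).
Qed.

Lemma lie_laplacian_p1 : lie (\sum_j D j * D j) (\sum_i y i) = (\sum_i D i) *+ 2.
Proof. by rewrite lie_sumr -sumrMnl; apply: eq_bigr => i _; rewrite lie_laplacian_y. Qed.

Let X := \sum_i D i * y i * D i.
Let Xs := \sum_i y i * D i * y i.

(** Rewriting D_i y_i^2 and y_i^2 D_i in terms of y_i D_i y_i leaves commutators of J_i with y_i,
    which cancel in the sum over i. *)
Lemma lie_laplacian_p3 :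
  lie (\sum_j D j * D j) (\sum_i y i ^+ 3) = Xs *+ 6.
Proof.
rewrite lie_sumr (eq_bigr (fun i => (y i * D i * y i) *+ 6 + (J i * y i - y i * J i) *+ 2)).
  by rewrite big_split /= !sumrMnl sumrB sum_J_y subrr mul0rn addr0.
move=> i _; rewrite !exprS expr0 mulr1 !lieMr lie_laplacian_y.
have -> : J i = D i * y i - y i * D i - 1 by rewrite (chDyi C) -/(J i); ncr.
by rewrite !mulrS; ncr.
Qed.

Lemma lie_laplacian_Xs : lie (\sum_j D j * D j) Xs = X *+ 4.
Proof.
rewrite /Xs lie_sumr (eq_bigr (fun i => (D i * y i * D i) *+ 4 + (D i * J i - J i * D i) *+ 2)).
  by rewrite big_split /= !sumrMnl sumrB sum_J_D subrr mul0rn addr0.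
move=> i _; rewrite !lieMr lie_laplacian_y lie_laplacian_D.
have -> : J i = D i * y i - y i * D i - 1 by rewrite (chDyi C) -/(J i); ncr.
by rewrite !mulrS; ncr.
Qed.

(** The squares of t_ij occur on both sides. For distinct i, j, l, [chtt] turns t_il t_ij into t_jl
    t_il, a term of the right side with j and l exchanged. *)
Lemma sum_Jt i : \sum_(j | j != i) J i * t i j = \sum_(j | j != i) J j * t i j.
Proof.
transitivity (\sum_(j | j != i) (t i j * t i j + \sum_(l | (l != i) && (l != j)) t i l * t i j)).
  by apply: eq_bigr => j ji; rewrite {1}/J (bigD1 j) //= mulrDl mulr_suml.
transitivity (\sum_(j | j != i)
  (t i j * t i j + \sum_(l | (l != i) && (l != j)) t j l * t i j)); last first.
  apply: eq_bigr => j ji; rewrite [J j](bigD1 i) 1?eq_sym //= mulrDl mulr_suml (chtC C j i).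
  by congr (_ + _); apply: eq_bigl => l; rewrite andbC.
rewrite !big_split /=; congr (_ + _).
rewrite [RHS](exchange_big_dep (fun l => l != i)) /=; last by move=> j l _ /andP[] //.
apply: eq_bigr => j ji; apply: eq_big => l; first by rewrite ji /= (eq_sym j).
by case/andP=> li lj; rewrite (chtt C) // 1?eq_sym // (chtC C j).
Qed.

Lemma sum_Dy_yD i :
  \sum_(j | j != i) (y j * D j * t i j + D i * y i * t i j) =
  \sum_(j | j != i) (D j * y j * t i j + y i * D i * t i j).
Proof.
apply/eqP; rewrite -subr_eq0 -sumrB; apply/eqP.
have /eqP := sum_Jt i; rewrite -subr_eq0 -sumrB => /eqP sJ; rewrite -[RHS]sJ.
have JE j : J j = D j * y j - y j * D j - 1 by rewrite (chDyi C) -/(J j); ncr.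
by apply: eq_bigr => j ji; rewrite !JE; ncr.
Qed.

(** For a single j the transposition terms leave (J_i - J_j) t_ij, which need not vanish; their sum
    over j does, by [sum_Dy_yD]. *)
Lemma lie_X_y i : lie X (y i) = D i * y i + y i * D i.
Proof.
rewrite /X lie_suml (bigD1 i) //= !lieMl lie_Dyi.
rewrite (eq_bigr (fun j => - (D j * y j * t i j) - y i * D i * t i j)); last first.
  move=> j ji; have ij : i != j by rewrite eq_sym.
  rewrite !lieMl lie_Dy_neq // {1}/lie (chyy C i j) subrr mulr0 add0r.
  rewrite (chtC C j i) mulrN mulNr mulNr t_yr // -!mulrA t_Dr //; ncr.
rewrite {1}/lie subrr mulr0 add0r.
have -> : (1 + J i) * y i * D i = y i * D i + \sum_(j | j != i) y j * D j * t i j.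
  rewrite /J mulrDl mul1r mulrDl mulr_suml mulr_suml; congr (_ + _).
  apply: eq_bigr => j ji; have ij : i != j by rewrite eq_sym.
  by rewrite (chty C) // -mulrA (chtD C) // mulrA.
have -> : D i * y i * (1 + J i) = D i * y i + \sum_(j | j != i) D i * y i * t i j.
  by rewrite mulrDr mulr1 mulr_sumr.
have := sum_Dy_yD i; rewrite !big_split /= => e.
transitivity (D i * y i + y i * D i + (\sum_(j | j != i) y j * D j * t i j +
  \sum_(j | j != i) D i * y i * t i j) - (\sum_(j | j != i) D j * y j * t i j
   + \sum_(j | j != i) y i * D i * t i j)); last by rewrite e; ncr.
by rewrite !sumrN; ncr.
Qed.

Lemma lie_Xs_D i : lie Xs (D i) = - (D i * y i + y i * D i).
Proof.
rewrite /Xs lie_suml (bigD1 i) //= !lieMl (lieN (y i)) lie_Dyi.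
rewrite (eq_bigr (fun j => y j * D j * t i j + D i * y i * t i j)); last first.
  move=> j ji; have ij : i != j by rewrite eq_sym.
  rewrite !lieMl (lieN (y j)) lie_Dy_neq // {1}/lie (chDD C i j) subrr mulr0 add0r opprK.
  have -> : D i * y i * t i j = t i j * (D j * y j) by rewrite -mulrA -t_yr // mulrA -t_Dr // mulrA.
  ncr.
rewrite {1}/lie subrr mulr0 add0r.
have -> : - (1 + J i) * D i * y i = - (D i * y i) - \sum_(j | j != i) D j * y j * t i j.
  rewrite /J mulNr mulNr mulrDl mul1r mulrDl mulr_suml mulr_suml opprD; congr (_ - _).
  apply: eq_bigr => j ji; have ij : i != j by rewrite eq_sym.
  by rewrite (chtD C) // -mulrA (chty C) // mulrA.
have -> : y i * D i * - (1 + J i) = - (y i * D i) - \sum_(j | j != i) y i * D i * t i j.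
  by rewrite mulrN mulrDr mulr1 mulr_sumr opprD.
rewrite sum_Dy_yD big_split /=; ncr.
Qed.

Lemma lie_X_D i : lie X (D i) = - (D i * D i).
Proof.
rewrite /X lie_suml (bigD1 i) //= !lieMl (lieN (y i)) lie_Dyi.
rewrite (eq_bigr (fun j => D j * t i j * D j)); last first.
  move=> j ji; have ij : i != j by rewrite eq_sym.
  by rewrite !lieMl (lieN (y j)) lie_Dy_neq // /lie (chDD C i j); ncr.
have lDD : lie (D i) (D i) = 0 by rewrite /lie subrr.
rewrite lDD mulr0 mul0r addr0 add0r.
have -> : D i * - (1 + J i) * D i = - (D i * D i) - \sum_(j | j != i) D i * t i j * D i.
  by rewrite /J mulrN mulrDr mulr1 mulNr mulrDl opprD mulr_sumr mulr_suml.
rewrite -addrA -sumrN -big_split /= big1 ?addr0 // => j ji.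
have ij : i != j by rewrite eq_sym.
by rewrite -!mulrA t_Dr // (chtD C) // !mulrA (chDD C i j) addNr.
Qed.

Lemma lie_Xs_y i : lie Xs (y i) = y i * y i.
Proof.
rewrite /Xs lie_suml (bigD1 i) //= !lieMl lie_Dyi.
rewrite (eq_bigr (fun j => - (y j * t i j * y j))); last first.
  move=> j ji; have ij : i != j by rewrite eq_sym.
  by rewrite !lieMl lie_Dy_neq // (chtC C j i) /lie (chyy C i j); ncr.
have lyy : lie (y i) (y i) = 0 by rewrite /lie subrr.
rewrite lyy mulr0 mul0r addr0 add0r.
have -> : y i * (1 + J i) * y i = y i * y i + \sum_(j | j != i) y i * t i j * y i.
  by rewrite /J mulrDr mulr1 mulrDl mulr_sumr mulr_suml.
rewrite -addrA -big_split /= big1 ?addr0 // => j ji.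
have ij : i != j by rewrite eq_sym.
by rewrite -!mulrA t_yr // (chty C) // !mulrA (chyy C i j) subrr.
Qed.

Let T := \sum_i J i.

(** T runs over ordered pairs. Those avoiding i commute with a_i, while (i, j) and (j, i) contribute
    equally, whence the factor 2. *)
Lemma lie_T_equiv (a : I -> E) i :
  (forall i j, i != j -> t i j * a i = a j * t i j) ->
  (forall i j l, i != j -> l != i -> l != j -> t i j * a l = a l * t i j) ->
  lie T (a i) = (J i * a i - a i * J i) *+ 2.
Proof.
move=> ta tal; rewrite /T lie_suml (bigD1 i) //= mulr2n {1}/lie; congr (_ + _).
rewrite /J mulr_suml mulr_sumr -sumrB; apply: eq_bigr => j ji.
rewrite lie_suml (bigD1 i) 1?eq_sym //= (chtC C j i) big1 ?addr0 // => l /andP[lj li].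
by rewrite /lie tal 1?eq_sym ?subrr // 1?eq_sym.
Qed.

(* T corrects [2 [Xs, X]] so that its commutator with D_i is a multiple of the
   single word D_i y_i D_i, and not of the symmetrized word. *)
Let H := lie Xs X *+ 2 + T.

Lemma lie_H a :
  lie H a = (lie Xs (lie X a) - lie X (lie Xs a)) *+ 2 + lie T a.
Proof. by rewrite -jacobi /H !mulr2n; ncr. Qed.

Lemma lieNr (a b : E) : lie a (- b) = - lie a b.
Proof. ncr. Qed.

Lemma lieDr (a b c : E) : lie a (b + c) = lie a b + lie a c.
Proof. ncr. Qed.

Let JE i : J i = D i * y i - y i * D i - 1.
Proof. by rewrite (chDyi C) -/(J i); ncr. Qed.

Lemma lie_H_D i : lie H (D i) = (D i * y i * D i) *+ 12.
Proof.
rewrite lie_H lie_X_D lie_Xs_D !lieNr lieDr !lieMr !lie_X_D !lie_Xs_D !lie_X_y.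
rewrite (lie_T_equiv i (chtD C) (chtDl C)) JE !mulrS mulr0n; ncr.
Qed.

Lemma lie_H_y i : lie H (y i) = - (y i * D i * y i) *+ 12.
Proof.
rewrite lie_H lie_X_y lie_Xs_y !lieDr !lieMr !lie_X_y !lie_Xs_D !lie_Xs_y.
rewrite (lie_T_equiv i (chty C) (chtyl C)) JE !mulrS mulr0n; ncr.
Qed.

Let U i := D i * y i.

(** The two terms of the Leibniz rule are multiples of U_i^2 with coefficients 12 and -12. *)
Lemma lie_H_U i : lie H (U i) = 0.
Proof. by rewrite lieMr lie_H_D lie_H_y !mulrS mulr0n; ncr. Qed.

Context {cs : seq E} (cs_central : forall c x, c \in cs -> c * x = x * c).
Let Q i := \prod_(c <- cs) (U i + c).

Lemma t_U i j : i != j -> t i j * U i = U j * t i j.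
Proof. by move=> ij; rewrite /U mulrA (chtD C) // -mulrA (chty C) // mulrA. Qed.

Lemma t_U_fixed i j l : i != j -> l != i -> l != j -> t i j * U l = U l * t i j.
Proof. by move=> ij li lj; rewrite /U mulrA (chtDl C) // -mulrA (chtyl C) // mulrA. Qed.

Lemma prod_intertwine (a b x : E) : x * a = b * x ->
  x * (\prod_(c <- cs) (a + c)) = (\prod_(c <- cs) (b + c)) * x.
Proof.
move=> xab; elim: cs cs_central => [|c s IH] cen; first by rewrite !big_nil mulr1 mul1r.
rewrite !big_cons mulrA mulrDr xab -(cen c x) ?mem_head // -mulrDl -!mulrA IH //.
by move=> d z ds; apply: cen; rewrite in_cons ds orbT.
Qed.

Lemma t_word i j : i != j -> t i j * dunkl_word D y cs i = dunkl_word D y cs j * t i j.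
Proof. by move=> ij; rewrite mulrA (prod_intertwine (t_U ij)) -mulrA (chtD C) // mulrA. Qed.

Lemma t_word_fixed i j l : i != j -> l != i -> l != j ->
  t i j * dunkl_word D y cs l = dunkl_word D y cs l * t i j.
Proof.
move=> ij li lj.
by rewrite mulrA (prod_intertwine (t_U_fixed ij li lj)) -mulrA (chtDl C) // mulrA.
Qed.

Lemma lie_prod h i : (forall c, c \in cs -> lie h c = 0) -> lie h (U i) = 0 ->
  lie h (Q i) = 0.
Proof.
rewrite /Q => + hU; elim: cs => [|c s IH] cen; first by rewrite big_nil /lie; ncr.
rewrite big_cons lieMr lieDr hU cen ?mem_head // IH ?addr0 ?mul0r ?mulr0 ?addr0 //.
by move=> d ds; apply: cen; rewrite in_cons ds orbT.
Qed.

(** H commutes with U_i and with the central elements, so it only acts on the last D_i of each word.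
    T commutes with the sum over i and drops out; hence X and Xs alone raise the words, and T itself
    need not be transferred. *)
Lemma lie_lie_word :
  lie (lie Xs X) (\sum_i dunkl_word D y cs i) *+ 2 = (\sum_i U i * dunkl_word D y cs i) *+ 12.
Proof.
have HL : lie H (\sum_i dunkl_word D y cs i) = (\sum_i U i * dunkl_word D y cs i) *+ 12.
  rewrite lie_sumr -sumrMnl; apply: eq_bigr => i _.
  rewrite lieMr lie_prod ?lie_H_U // => [|c cc]; last first.
    by rewrite /lie -(cs_central _ cc) subrr.
  rewrite mul0r add0r lie_H_D mulrnAr /dunkl_word !mulrA; congr (_ * _ *+ _).
  by rewrite -[_ * D i * y i]mulrA -/(U i) (@prod_intertwine (U i) (U i)).
rewrite -HL /H.
have T0 : lie T (\sum_i dunkl_word D y cs i) = 0.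
  rewrite lie_sumr; under eq_bigr => i _ do rewrite (lie_T_equiv i t_word t_word_fixed).
  rewrite sumrMnl sumrB; under eq_bigr do rewrite /J mulr_suml.
  under [X in _ - X]eq_bigr do rewrite /J mulr_sumr.
  rewrite (sum_swap (G := fun i j => dunkl_word D y cs i * t i j)) ?subrr ?mul0rn // => i j ij.
  by rewrite t_word // (chtC C i j).
transitivity (lie (lie Xs X *+ 2) (\sum_i dunkl_word D y cs i) +
  lie T (\sum_i dunkl_word D y cs i)).
  by rewrite T0 addr0 !mulr2n; ncr.
rewrite !mulr2n; ncr.
Qed.

Lemma DU_exchange i j : i != j -> D j * U i = (U i - t i j) * D j.
Proof.
move=> ij; rewrite /U mulrA (chDD C) -mulrA (chDy C) 1?eq_sym // (chtC C j).
rewrite mulrBr -(t_Dr ij); ncr.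
Qed.

Lemma U_shift_comm i j : i != j -> U j * (U i - t i j) = (U i - t i j) * U j.
Proof.
move=> ij; have ji : j != i by rewrite eq_sym.
have yU : y j * U i = U i * y j + t i j * y i.
  have -> : U i * y j = D i * y j * y i by rewrite /U -!mulrA (chyy C i).
  by rewrite (chDy C) // /U; ncr.
have e : D j * t i j * y i = U j * t i j by rewrite -mulrA (chty C) // mulrA.
transitivity (D j * (y j * U i) - U j * t i j); first by rewrite /U; ncr.
have e2 : D j * (U i * y j) = (U i - t i j) * (D j * y j).
  by rewrite (mulrA (D j)) (DU_exchange ij) mulrA.
rewrite yU mulrDr e2 (mulrA (D j)) e -/(U j); ncr.
Qed.

(* U_i and U_j - t_ij play the role of commuting Cherednik operators. *)
Lemma factor_swap i j c : i != j -> (forall x, c * x = x * c) ->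
  (U j + c) * (U i - t i j + c) = (U i + c) * (U j - t i j + c).
Proof.
move=> ij cc; have ji : j != i by rewrite eq_sym.
have e5 : t i j * U j = U i * t i j by rewrite (chtC C) t_U.
transitivity (U j * (U i - t i j) + c * U j + U i * c - c * t i j + c * c).
  by rewrite (cc (U j)) -(cc (U i)); ncr.
by rewrite U_shift_comm // mulrBl e5; ncr.
Qed.

Lemma comm_prod (a b : E) : a * b = b * a ->
  a * (\prod_(c <- cs) (b + c)) = (\prod_(c <- cs) (b + c)) * a.
Proof. exact: prod_intertwine. Qed.

End Derivations.

(** * Commutativity of the words A_i, and the operator raising their powers *)

Section Commute.
Context {D y : I -> E} {t : I -> I -> E} (C : cherednik D y t).
Let U i := D i * y i.

(** Induction on the factors: [mid] moves the head of the second product next to the head of the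
    first, where [factor_swap] applies. *)
Lemma prod_swap (cs : seq E) i j : (forall c x, c \in cs -> c * x = x * c) -> i != j ->
  (\prod_(c <- cs) (U j + c)) * (\prod_(c <- cs) (U i - t i j + c)) =
  (\prod_(c <- cs) (U i + c)) * (\prod_(c <- cs) (U j - t i j + c)).
Proof.
move=> + ij; have ji : j != i by rewrite eq_sym.
elim: cs => [|c s IH] cen; first by rewrite !big_nil.
have scen d x : d \in s -> d * x = x * d.
  by move=> ds; apply: cen; rewrite in_cons ds orbT.
have cc x : c * x = x * c by apply: cen; rewrite mem_head.
have mid a b : a * b = b * a ->
  (\prod_(d <- s) (a + d)) * (b + c) = (b + c) * (\prod_(d <- s) (a + d)).
  by move=> ab; rewrite mulrDr mulrDl cc (comm_prod scen (esym ab)).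
rewrite !big_cons -!mulrA (mulrA (\prod_(d <- s) (U j + d))).
rewrite (mulrA (\prod_(d <- s) (U i + d))).
rewrite !mid ?U_shift_comm //; last by rewrite (chtC C) U_shift_comm.
by rewrite -!mulrA IH // !mulrA factor_swap.
Qed.

Context {cs : seq E} (cs_central : forall c x, c \in cs -> c * x = x * c).
Let A := dunkl_word D y cs.

(** Moving D_i to the right through A_j replaces U_j by U_j - t_ij in every factor. The products
    obtained from the two orders agree by [prod_swap]. *)
Lemma dunkl_word_comm i j : A i * A j = A j * A i.
Proof.
have [->//|ij] := eqVneq i j; have ji : j != i by rewrite eq_sym.
rewrite /A /dunkl_word !mulrA -[_ * D i * _]mulrA -[_ * D j * (\prod_(_ <- _) _)]mulrA.
rewrite (prod_intertwine cs_central (DU_exchange C ij)).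
rewrite (prod_intertwine cs_central (DU_exchange C ji)).
by rewrite !mulrA (chtC C j i) -(prod_swap cs_central ij) -!mulrA (chDD C i j).
Qed.

(** D_i U_j = (U_j - t_ij) D_i, and U_j - t_ij commutes with U_i; hence A_i U_j = (U_j - t_ij)
    A_i. *)
Lemma lie_UA i j : i != j -> lie (U j) (A i) = t i j * A i.
Proof.
move=> ij; have ji : j != i by rewrite eq_sym.
have UW : (U j - t j i) * U i = U i * (U j - t j i) by rewrite U_shift_comm.
have e := comm_prod cs_central UW; have e' := DU_exchange C ji.
transitivity (U j * A i - \prod_(c <- cs) (U i + c) * (D i * U j)).
  by congr (_ - _); rewrite -mulrA.
by rewrite e' mulrA -e (chtC C j i) /A /dunkl_word -/(U i); ncr.
Qed.

Lemma lie_UAi i : lie (U i) (A i) = - (A i * (1 + \sum_(j | j != i) t i j)).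
Proof.
have -> : 1 + \sum_(j | j != i) t i j = D i * y i - y i * D i by rewrite (chDyi C); ncr.
have e := comm_prod cs_central (erefl (U i * U i)).
rewrite /lie /A /dunkl_word -/(U i) (mulrA (U i)) e.
move: (\prod_(c <- cs) _) => q; rewrite /U; ncr.
Qed.

(** The term with index j contributes A_j A_i t_ij. It cancels against the summand - A_i t_ij A_i of
    the diagonal term, because A_i and A_j commute. *)
Lemma lie_BA i : lie (\sum_j U j * A j) (A i) = - (A i * A i).
Proof.
rewrite lie_suml (bigD1 i) //=.
rewrite (eq_bigr (fun j => A j * A i * t i j)); last first.
  move=> j ji; have ij : i != j by rewrite eq_sym.
  have AA : lie (A j) (A i) = 0 by rewrite /lie dunkl_word_comm subrr.
  rewrite lieMl (lie_UA ij) AA mulr0 add0r.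
  by rewrite (t_word C cs_central ij) -mulrA (chtC C) (t_word C cs_central ji) mulrA.
rewrite lieMl lie_UAi {1}/lie subrr mulr0 add0r mulrDr mulr1 mulNr mulrDl opprD.
rewrite mulr_sumr mulr_suml -addrA -sumrN -big_split /= big1 ?addr0 // => j ji.
have ij : i != j by rewrite eq_sym.
by rewrite -mulrA (t_word C cs_central ij) mulrA (dunkl_word_comm i j) addNr.
Qed.

Lemma lie_BA_exp i n : lie (\sum_j U j * A j) (A i ^+ n) = - (A i ^+ n.+1 *+ n).
Proof.
elim: n => [|n IH]; first by rewrite expr0 mulr0n oppr0 /lie; ncr.
by rewrite exprS lieMr IH lie_BA mulNr mulrN -opprD mulrnAr -mulrA -!exprS -mulrS.
Qed.

Lemma lie_B_power_sum n : lie (\sum_j U j * A j) (\sum_i A i ^+ n) =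
  - (\sum_i A i ^+ n.+1) *+ n.
Proof.
rewrite lie_sumr mulNrn -sumrMnl -sumrN; apply: eq_bigr => i _; exact: lie_BA_exp.
Qed.

End Commute.

(** * What a relation closed under ring operations inherits from the Laplacian *)

Section Shift.
Context {D D' y : I -> E} {t t' : I -> I -> E}.
Context (C : cherednik D y t) (C' : cherednik D' y t').
Context (good : E -> E -> Prop)
  (goodD : forall a a' b b', good a a' -> good b b' -> good (a + b) (a' + b'))
  (goodN : forall a a', good a a' -> good (- a) (- a'))
  (goodM : forall a a' b b', good a a' -> good b b' -> good (a * b) (a' * b'))
  (goodMn : forall a a' n, good (a *+ n.+1) (a' *+ n.+1) -> good a a')
  (good_y : forall n, good (\sum_i y i ^+ n) (\sum_i y i ^+ n))
  (good_laplacian : good (\sum_i D i * D i) (\sum_i D' i * D' i)).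

Lemma good_lie a a' b b' : good a a' -> good b b' -> good (lie a b) (lie a' b').
Proof. by move=> ga gb; apply: goodD; [|apply: goodN]; apply: goodM. Qed.

(** By induction on [cs]: a new factor U_i + c gives the raised sum of the second conjunct plus c
    times the old sum. The second conjunct is also the operator that later raises powers of the
    A_i. *)
Lemma good_words cs : (forall c x, c \in cs -> c * x = x * c /\ good c c) ->
  good (\sum_i dunkl_word D y cs i) (\sum_i dunkl_word D' y cs i) /\
  good (\sum_i D i * y i * dunkl_word D y cs i) (\sum_i D' i * y i * dunkl_word D' y cs i).
Proof.
have gXs : good (\sum_i y i * D i * y i) (\sum_i y i * D' i * y i).
  (* [goodMn] divides by n + 1, so the values 5, 3, 1 and 11 here and below remove the factors 6, 4,
     2 and 12 of the commutator formulas. *)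
  apply: (goodMn (n := 5)); rewrite -(lie_laplacian_p3 C) -(lie_laplacian_p3 C').
  by apply: good_lie => //; exact: good_y 3.
have gX : good (\sum_i D i * y i * D i) (\sum_i D' i * y i * D' i).
  apply: (goodMn (n := 3)); rewrite -(lie_laplacian_Xs C) -(lie_laplacian_Xs C').
  exact: good_lie.
have gD : good (\sum_i D i) (\sum_i D' i).
  apply: (goodMn (n := 1)); rewrite -(lie_laplacian_p1 C) -(lie_laplacian_p1 C').
  by apply: good_lie => //; exact: good_y 1.
have step cs' : (forall c x, c \in cs' -> c * x = x * c) ->
  good (\sum_i dunkl_word D y cs' i) (\sum_i dunkl_word D' y cs' i) ->
  good (\sum_i D i * y i * dunkl_word D y cs' i) (\sum_i D' i * y i * dunkl_word D' y cs' i).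
  move=> cen g1; apply: (goodMn (n := 11)).
  rewrite -(lie_lie_word C cen) -(lie_lie_word C' cen) !mulr2n.
  by apply: goodD; do 2 apply: good_lie => //.
move=> cen; have cen1 c x : c \in cs -> c * x = x * c by move=> /cen-/(_ x)[].
suff g1 : good (\sum_i dunkl_word D y cs i) (\sum_i dunkl_word D' y cs i).
  by split=> //; exact: step.
elim: cs cen cen1 => [|c cs IH] cen cen1.
  by under eq_bigr do rewrite /dunkl_word big_nil mul1r;
     under [X in good _ X]eq_bigr do rewrite /dunkl_word big_nil mul1r.
have wordS D0 : \sum_i dunkl_word D0 y (c :: cs) i =
  \sum_i D0 i * y i * dunkl_word D0 y cs i + c * \sum_i dunkl_word D0 y cs i.
  rewrite mulr_sumr -big_split /=; apply: eq_bigr => i _.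
  by rewrite /dunkl_word big_cons -mulrA mulrDl.
have tcs : forall d, d \in cs -> d \in c :: cs by move=> d ds; rewrite in_cons ds orbT.
rewrite !wordS; have g := IH (fun d x ds => cen d x (tcs d ds)) (fun d x ds => cen1 d x (tcs d ds)).
apply: goodD; first by apply: step => // d x ds; apply: cen1; exact: tcs.
by apply: goodM => //; have [] := cen c 0 (mem_head _ _).
Qed.

(** Each commutator with the sum of the U_j A_j raises the exponent by one, up to a nonzero integer.
    The induction starts at exponent 1, since the commutator at exponent 0 vanishes. *)
Lemma good_power_sum cs n : (forall c x, c \in cs -> c * x = x * c /\ good c c) ->
  good (\sum_i dunkl_word D y cs i ^+ n.+1) (\sum_i dunkl_word D' y cs i ^+ n.+1).
Proof.
move=> cen; have [g1 g2] := good_words cen.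
have cen1 c x : c \in cs -> c * x = x * c by move=> /cen-/(_ x)[].
elim: n => [|n IH].
  by under eq_bigr do rewrite expr1; under [X in good _ X]eq_bigr do rewrite expr1.
apply: (goodMn (n := n)).
have e := lie_B_power_sum C cen1 n.+1; have e' := lie_B_power_sum C' cen1 n.+1.
rewrite mulNrn in e; rewrite mulNrn in e'.
by rewrite -[X in good X _]opprK -[X in good _ X]opprK -e -e'; apply: goodN; apply: good_lie.
Qed.

End Shift.
End NcRing.

(** * The ring of endomorphisms *)

Section Endomorphisms.
Variables (K : pzRingType) (V : lmodType K).

(** Bundling makes composition the product of a ring, so that the identities above apply to
    operators. Equality is Leibniz equality, by function extensionality and proof irrelevance. *)
Record endo := Endo { efun :> V -> V; endo_linear : linear efun }.

HB.instance Definition _ (f : endo) :=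
  GRing.isLinear.Build K V V *:%R (efun f) (@endo_linear f).

HB.instance Definition _ := gen_eqMixin endo.
HB.instance Definition _ := gen_choiceMixin endo.

Lemma endoP (f g : endo) : f =1 g -> f = g.
Proof.
case: f g => f lf [g lg] /= /funext fg; rewrite fg in lf *.
by rewrite (Prop_irrelevance lf lg).
Qed.

Definition endo_of (f : {linear V -> V}) : endo := Endo (@linearP _ _ _ _ f).

Definition endo_add (f g : endo) := endo_of (f \+ g).
Definition endo_opp (f : endo) := endo_of (\- f).
Definition endo_mul (f g : endo) := endo_of (f \o g).

Lemma endo_addA : associative endo_add.
Proof. by move=> f g h; apply: endoP => x /=; rewrite addrA. Qed.
Lemma endo_addC : commutative endo_add.
Proof. by move=> f g; apply: endoP => x /=; rewrite addrC. Qed.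
Lemma endo_add0 : left_id (endo_of \0) endo_add.
Proof. by move=> f; apply: endoP => x /=; rewrite add0r. Qed.
Lemma endo_addN : left_inverse (endo_of \0) endo_opp endo_add.
Proof. by move=> f; apply: endoP => x /=; rewrite addNr. Qed.

HB.instance Definition _ := GRing.isZmodule.Build endo
  endo_addA endo_addC endo_add0 endo_addN.

Lemma endo_mulA : associative endo_mul.
Proof. by move=> f g h; apply: endoP. Qed.
Lemma endo_mul1 : left_id (endo_of idfun) endo_mul.
Proof. by move=> f; apply: endoP. Qed.
Lemma endo_mulr1 : right_id (endo_of idfun) endo_mul.
Proof. by move=> f; apply: endoP. Qed.
Lemma endo_mulDl : left_distributive endo_mul +%R.
Proof. by move=> f g h; apply: endoP. Qed.
Lemma endo_mulDr : right_distributive endo_mul +%R.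
Proof. by move=> f g h; apply: endoP => x /=; rewrite linearD. Qed.

HB.instance Definition _ := GRing.Zmodule_isPzRing.Build endo
  endo_mulA endo_mul1 endo_mulr1 endo_mulDl endo_mulDr.

Lemma endoD (f g : endo) x : (f + g) x = f x + g x. Proof. by []. Qed.
Lemma endoN (f : endo) x : (- f) x = - f x. Proof. by []. Qed.
Lemma endoM (f g : endo) x : (f * g) x = f (g x). Proof. by []. Qed.
Lemma endo0 x : (0 : endo) x = 0. Proof. by []. Qed.
Lemma endo1 x : (1 : endo) x = x. Proof. by []. Qed.
Lemma endoMn (f : endo) n x : (f *+ n) x = f x *+ n.
Proof. by elim: n => // n IH; rewrite !mulrS endoD IH. Qed.
Lemma efunD (f : endo) x y : f (x + y) = f x + f y. Proof. exact: linearD. Qed.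
Lemma efunZ (f : endo) c x : f (c *: x) = c *: f x. Proof. exact: linearZ. Qed.
Lemma endo_sum (I : Type) (r : seq I) (P : pred I) (F : I -> endo) x :
  (\sum_(i <- r | P i) F i) x = \sum_(i <- r | P i) F i x.
Proof. by elim/big_rec2: _ => // i f y _ <-. Qed.

End Endomorphisms.

(** * Dunkl operators of S_N *)

(** The divided difference, locked so that simplification does not expose the quotient. *)
HB.lock Definition ddiff (K : numFieldType) (N : nat) (i j : 'I_N) (p : {mpoly K[N]}) :=
  mquot (p - msym (tperm i j) p) ('X_i - 'X_j).

Section TypeA.
Context {K : numFieldType} {N : nat}.
Local Notation Pol := {mpoly K[N]}.
Implicit Types (i j l : 'I_N) (p q g : Pol) (w : 'S_N).

Lemma subX_neq0 i j : j != i -> 'X_i - 'X_j != 0 :> Pol.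
Proof.
move=> ji; rewrite subr_eq0; apply/eqP => /(congr1 (fun p => p@_(U_(i)%MM))).
rewrite !mcoeffXU eqxx (negbTE ji) => /eqP; by rewrite oner_eq0.
Qed.

Lemma msymXU w i : msym w 'X_i = 'X_(w i) :> Pol.
Proof. by rewrite /msym mmapX mmap1U. Qed.

Lemma msym_mderiv w i p : msym w (mderiv i p) = mderiv (w i) (msym w p).
Proof.
apply/mpolyP => m; rewrite mcoeff_sym !mcoeff_deriv mcoeff_sym mnmE.
congr (_@__ *+ _); apply/mnmP => k; rewrite !mnmE.
by rewrite (inj_eq perm_inj).
Qed.

Lemma mderivXU i j : mderiv i 'X_j = (j == i)%:R :> Pol.
Proof.
rewrite mderivX mnm1E; case: eqVneq => [->|_]; last by rewrite scale0r.
have -> : (U_(i) - U_(i) = 0 :> 'X_{1..N})%MM by apply/mnmP => k; rewrite mnmBE subnn mnm0E.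
by rewrite mpolyX0 scale1r.
Qed.

(** With s the transposition, p1 p2 - s(p1 p2) = (p1 - s p1) p2 + s(p1) (p2 - s p2), so divisibility
    passes from the variables to all monomials. *)
Lemma ddiffP i j p : j != i -> ddiff i j p * ('X_i - 'X_j) = p - msym (tperm i j) p.
Proof.
move=> ji; rewrite unlock; apply: mquot_mul.
pose P p := exists r, p - msym (tperm i j) p = r * ('X_i - 'X_j).
have PM p1 p2 : P p1 -> P p2 -> P (p1 * p2).
  case=> r1 e1 [r2 e2]; exists (r1 * p2 + msym (tperm i j) p1 * r2).
  by rewrite mulrDl mulrAC -e1 -mulrA -e2 msymM; ring.
have P1 : P 1 by exists 0; rewrite msym1 subrr mul0r.
have PX k : P 'X_k.
  rewrite /P msymXU; case: tpermP => [->|->|_ _].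
  - by exists 1; rewrite mul1r.
  - by exists (-1); ring.
  - by exists 0; rewrite subrr mul0r.
rewrite -/(P p); elim/mpolyind: p => [|c a p _ _ [r e]].
  by exists 0; rewrite msym0 subrr mul0r.
have [r' e'] : P 'X_[a].
  rewrite mpolyXE_id; elim/big_ind: _ => [//|u v|k _]; first exact: PM.
  elim: (a k) => [|n IH]; first by rewrite expr0.
  by rewrite exprS; apply: PM IH; exact: PX.
exists (c *: r' + r); rewrite mulrDl -e -scalerAl -e' msymD msymZ.
by rewrite scalerBr opprD addrACA.
Qed.

Lemma ddiff_eq i j p q : j != i -> q * ('X_i - 'X_j) = p - msym (tperm i j) p -> ddiff i j p = q.
Proof. by move=> ji; rewrite -ddiffP // => /(mulIf (subX_neq0 ji)). Qed.

Lemma ddiff_linear i j : j != i -> linear (ddiff i j : Pol -> Pol).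
Proof.
move=> ji c p q; apply: ddiff_eq => //.
by rewrite mulrDl -scalerAl !ddiffP // msymD msymZ scalerBr opprD addrACA.
Qed.

Lemma ddiff_sym i j g : j != i -> msym (tperm i j) g = g -> ddiff i j g = 0.
Proof. by move=> ji e; apply: ddiff_eq => //; rewrite e subrr mul0r. Qed.

Lemma ddiffM_sym i j g p : j != i -> msym (tperm i j) g = g ->
  ddiff i j (g * p) = g * ddiff i j p.
Proof. by move=> ji e; apply: ddiff_eq => //; rewrite -mulrA ddiffP // msymM e mulrBr. Qed.

Lemma ddiffXl i j p : j != i ->
  ddiff i j ('X_i * p) = 'X_i * ddiff i j p + msym (tperm i j) p.
Proof.
move=> ji; apply: ddiff_eq => //.
by rewrite mulrDl -mulrA ddiffP // msymM msymXU tpermL; ring.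
Qed.

Lemma ddiffXr i j p : j != i ->
  ddiff i j ('X_j * p) = 'X_j * ddiff i j p - msym (tperm i j) p.
Proof.
move=> ji; apply: ddiff_eq => //.
by rewrite mulrDl -mulrA ddiffP // msymM msymXU tpermR; ring.
Qed.

Lemma ddiffX i j l p : j != i -> l != i -> l != j ->
  ddiff i j ('X_l * p) = 'X_l * ddiff i j p.
Proof. by move=> ji li lj; apply: ddiffM_sym => //; rewrite msymXU tpermD // eq_sym. Qed.

Lemma msym_ddiff w i j p : j != i -> msym w (ddiff i j p) = ddiff (w i) (w j) (msym w p).
Proof.
move=> ji; apply/esym/ddiff_eq; first by rewrite (inj_eq perm_inj).
transitivity (msym w (ddiff i j p * ('X_i - 'X_j))); first by rewrite msymM msymB !msymXU.
rewrite ddiffP // msymB; congr (_ - _); rewrite -2!msymMm; congr (msym _ p).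
by rewrite -tpermJ conjgE !mulgA mulgV mul1g.
Qed.

Definition dunklA_fun (k : K) i p : Pol :=
  mderiv i p + k *: \sum_(j | j != i) ddiff i j p.

Lemma dunklA_linear k i : linear (dunklA_fun k i).
Proof.
move=> c p q; rewrite /dunklA_fun linearP /=.
rewrite (eq_bigr (fun j => c *: ddiff i j p + ddiff i j q)); last first.
  by move=> j ji; rewrite ddiff_linear.
by rewrite big_split /= -scaler_sumr !scalerDr !scalerA (mulrC k c) addrACA.
Qed.

Definition dunklA k i : endo Pol := Endo (dunklA_linear k i).

Lemma msym_dunklA w k i p : msym w (dunklA k i p) = dunklA k (w i) (msym w p).
Proof.
rewrite /= /dunklA_fun msymD msymZ msym_mderiv; congr (_ + _ *: _).
rewrite [RHS](reindex_inj (@perm_inj _ w)) /= (raddf_sum (msym w)) /=.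
by apply: eq_big => j; rewrite ?(inj_eq perm_inj) // => ji; rewrite msym_ddiff.
Qed.

Lemma mulp_linear p : linear ( *%R p : Pol -> Pol).
Proof. by move=> c q r; rewrite mulrDr scalerAr. Qed.

Definition mulop p : endo Pol := Endo (mulp_linear p).

Lemma tswap_linear k i j : linear (fun p : Pol => k *: msym (tperm i j) p).
Proof. by move=> c p q; rewrite linearP /= scalerDr !scalerA mulrC. Qed.

Definition tswap k i j : endo Pol := Endo (tswap_linear k i j).

Lemma dunklA_rel k : cherednik_rel (dunklA k) (fun i => mulop 'X_i) (tswap k).
Proof.
split.
- by move=> i j; apply: endoP => p; rewrite !endoM /= mulrCA.
- by move=> i j; apply: endoP => p /=; rewrite tpermC.
- move=> i j ij; have ji : j != i by rewrite eq_sym.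
  apply: endoP => p; rewrite endoD endoN !endoM /= /dunklA_fun mderivM mderivXU.
  rewrite (negbTE ji) mul0r add0r (bigD1 j) //= [in RHS](bigD1 j) //= ddiffXr //.
  under eq_bigr => l /andP[li lj] do rewrite ddiffX 1?[j == l]eq_sym //.
  rewrite -mulr_sumr -!mul_mpolyC; ring.
- move=> i; apply: endoP => p; rewrite !endoD endo_sum !endoM /= /dunklA_fun.
  rewrite mderivM mderivXU eqxx mul1r.
  rewrite (eq_bigr (fun j => 'X_i * ddiff i j p + msym (tperm i j) p)); last first.
    by move=> j ji; rewrite ddiffXl.
  rewrite big_split /= -mulr_sumr -scaler_sumr -!mul_mpolyC; ring.
- move=> i j ij; apply: endoP => p; rewrite !endoM.
  by rewrite [LHS]/= msym_dunklA tpermL linearZ.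
- move=> i j l ij li lj; apply: endoP => p; rewrite !endoM.
  by rewrite [LHS]/= msym_dunklA tpermD 1?eq_sym // linearZ.
- move=> i j ij; apply: endoP => p; rewrite !endoM /= msymM msymXU tpermL.
  by rewrite scalerAr.
- move=> i j l ij li lj; apply: endoP => p; rewrite !endoM /= msymM msymXU.
  by rewrite tpermD 1?eq_sym // scalerAr.
- move=> i j l ij li lj; apply: endoP => p.
  change (k *: msym (tperm i l) (k *: msym (tperm i j) p) =
    k *: msym (tperm j l) (k *: msym (tperm i l) p)).
  rewrite 2!msymZ.
  congr (_ *: (_ *: _)).
  rewrite -2!msymMm; congr (msym _ p).
  have -> : tperm j l = ((tperm i j) ^ (tperm i l))%g.
    by rewrite tpermJ tpermL (tpermD ij lj) tpermC.
  by rewrite conjgE !mulgA mulgV mul1g.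
Qed.

Lemma endo_comm_X (F : endo Pol) :
  (forall i, lie F (mulop 'X_i) = 0) -> forall p, F p = p * F 1.
Proof.
move=> FX.
have FXp i p : F ('X_i * p) = 'X_i * F p.
  by have /(congr1 (fun f : endo Pol => f p)) := FX i; move/eqP; rewrite subr_eq0 => /eqP.
have FM (a : 'X_{1..N}) : forall p, F ('X_[a] * p) = 'X_[a] * F p.
  rewrite mpolyXE_id; apply: (big_ind (fun q => forall p, F (q * p) = q * F p)).
  - by move=> p; rewrite !mul1r.
  - by move=> q1 q2 e1 e2 p; rewrite -!mulrA e1 e2.
  move=> i _; elim: (a i) => [|n IH] p; first by rewrite expr0 !mul1r.
  by rewrite exprS -!mulrA FXp IH.
elim/mpolyind => [|c a p _ _ IH]; first by rewrite linear0 mul0r.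
by rewrite linearP /= IH -{1}['X_[a]]mulr1 FM mulrDl -scalerAl.
Qed.

Lemma dunklA1 k i : dunklA k i 1 = 0.
Proof.
rewrite /= /dunklA_fun -mpolyC1 mderivC big1 ?scaler0 ?addr0 // => j ji.
by rewrite ddiff_sym // mpolyC1 msym1.
Qed.

Lemma dunklA_cherednik k : cherednik (dunklA k) (fun i => mulop 'X_i) (tswap k).
Proof.
split; first exact: dunklA_rel.
move=> i j; apply/eqP; rewrite -subr_eq0; apply/eqP/endoP => p.
rewrite -/(lie (dunklA k i) (dunklA k j)) endo_comm_X; last exact: (lie_DD_y (dunklA_rel k)).
have -> : lie (dunklA k i) (dunklA k j) 1 =
  dunklA k i (dunklA k j 1) - dunklA k j (dunklA k i 1) by [].
by rewrite (dunklA1 k i) (dunklA1 k j) !linear0 addr0 mulr0.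
Qed.

End TypeA.

(** After sorting, the entry at position i is at least i. This bounds from below the degree of a
    monomial with distinct exponents. *)
Lemma sum_uniq_ge (s : seq nat) :
  uniq s -> (\sum_(0 <= i < size s) i <= \sum_(x <- s) x)%N.
Proof.
move=> us; rewrite -(perm_big _ (permEl (perm_sort leq s))) /= -(size_sort leq s).
have : sorted ltn (sort leq s).
  by rewrite ltn_sorted_uniq_leq sort_uniq us sort_sorted //; exact: leq_total.
move: (sort leq s) => {us} t st; rewrite [X in (_ <= X)%N](big_nth 0%N) !big_mkord.
apply: leq_sum => -[i it] _ /=; elim: i it => // i IH it.
apply: leq_ltn_trans (IH (ltnW it)) _.
by apply: (sorted_ltn_nth ltn_trans); rewrite ?inE // ltnW.
Qed.

(** * The Vandermonde polynomial *)

(** The product rule with the cofactors given by an equation: [c u] is the product of the other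
    factors, times [x]. In the induction [x] absorbs the factors already removed. *)
Lemma derivation_prod (A : idomainType) (d : A -> A) (T : eqType) (r : seq T)
    (F c : T -> A) (x : A) :
  d 1 = 0 -> (forall a b, d (a * b) = d a * b + a * d b) ->
  (forall u, u \in r -> F u != 0) ->
  (forall u, u \in r -> c u * F u = (\prod_(v <- r) F v) * x) ->
  d (\prod_(u <- r) F u) * x = \sum_(u <- r) d (F u) * c u.
Proof.
move=> d1 dM; elim: r x => [|u r IH] x F0 cF; first by rewrite !big_nil d1 mul0r.
rewrite !big_cons dM mulrDl; congr (_ + _).
  have := cF u (mem_head _ _); rewrite big_cons -mulrA => cu.
  by rewrite -mulrA; congr (_ * _); apply: (mulIf (F0 u (mem_head _ _))); rewrite cu mulrC.
rewrite (mulrC (F u)) -mulrA IH // => [v vr|v vr]; first by rewrite F0 // in_cons vr orbT.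
by rewrite cF ?in_cons ?vr ?orbT // big_cons; ring.
Qed.

HB.lock Definition vdm (K : numFieldType) (N : nat) : {mpoly K[N]} :=
  \prod_(i < N) \prod_(j < N | (i < j)%N) ('X_i - 'X_j).

Section Vandermonde.
Context {K : numFieldType} {N : nat}.
Local Notation Pol := {mpoly K[N]}.
Implicit Types (i j l : 'I_N) (p q g : Pol) (w : 'S_N).

Local Notation vdm := (vdm K N).

(** Negating the variables gives the factors of the determinant the sign 'X_i - 'X_j for i < j. *)
Let V : 'M[Pol]_N := Vandermonde N (\row_i - 'X_i).

Lemma vdm_det : vdm = \det V.
Proof.
rewrite det_Vandermonde unlock; apply: eq_bigr => i _; apply: eq_bigr => j _.
by rewrite !mxE opprK addrC.
Qed.

Lemma msym_vdm w : msym w vdm = (-1) ^+ w * vdm.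
Proof.
rewrite vdm_det -(det_map_mx (msym w)).
have -> : map_mx (msym w) V = col_perm w V.
  by apply/matrixP => i j; rewrite !mxE rmorphXn /= msymN msymXU.
by rewrite col_permE det_mulmx det_perm mulrC odd_permV.
Qed.

Lemma msym_tperm_vdm i j : j != i -> msym (tperm i j) vdm = - vdm.
Proof. by move=> ji; rewrite msym_vdm odd_tperm eq_sym ji mulN1r. Qed.

Lemma vdm_homog : vdm \is (\sum_(i < N) i)%N.-homog.
Proof.
rewrite vdm_det /determinant; apply: rpred_sum => s _.
rewrite -signr_odd mulr_sign; set q := \prod_i _.
suff qh : q \is (\sum_(i < N) i)%N.-homog by case: odd; rewrite ?dhomogN.
apply: (big_ind2 (fun q d => q \is d.-homog)); first exact: dhomog1.
  by move=> *; apply: dhomogM.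
move=> i _; rewrite !mxE -[X in X.-homog]mul1n; apply: dhomogMn.
by rewrite dhomogN dhomogX /= mdeg1.
Qed.

(** A monomial with two equal exponents is fixed by a transposition, so its coefficient equals its
    own opposite. Distinct exponents force degree at least 0 + 1 + ... + (N - 1). *)
Lemma antisym_deg_eq0 p d : (forall w, msym w p = (-1) ^+ w * p) ->
  p \is d.-homog -> (d < \sum_(i < N) i)%N -> p = 0.
Proof.
move=> pa ph dN; apply/mpolyP => m; rewrite mcoeff0; apply/eqP/contraT => pm.
have mi : injective m.
  move=> i j mij; apply/eqP/contraT => ij.
  have := mcoeff_sym p (tperm i j) m; rewrite pa odd_tperm ij mulN1r mcoeffN.
  have -> : [multinom m (tperm i j l) | l < N] = m.
    by apply/mnmP => l; rewrite mnmE; case: tpermP => [->|->|].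
  by move/eqP; rewrite eq_sym -subr_eq0 opprK -mulr2n -mulr_natl mulf_eq0 pnatr_eq0 (negbTE pm).
have md : mdeg m = d by apply: (dhomog_mf ph); rewrite mcoeff_msupp.
have := @sum_uniq_ge [seq m i | i <- enum 'I_N].
rewrite map_inj_uniq ?enum_uniq // size_map size_enum_ord => /(_ isT).
by rewrite big_mkord big_map big_enum /= -mdegE md leqNgt dN.
Qed.

Lemma mderiv_homog i p d : p \is d.+1.-homog -> mderiv i p \is d.-homog.
Proof.
move=> ph; apply/dhomogP => m; rewrite mcoeff_msupp mcoeff_deriv => mi.
have : (m + U_(i))%MM \in msupp p.
  by rewrite mcoeff_msupp; apply: contraNneq mi => ->; rewrite mul0rn.
by move/(dhomog_mf ph); rewrite /= mdegD mdeg1 addn1 => -[].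
Qed.

(** The Laplacian of [vdm] is antisymmetric and homogeneous of degree two below the least possible
    one, hence zero. *)
Lemma vdm_harmonic : \sum_(i < N) mderiv i (mderiv i vdm) = 0.
Proof.
(* Degrees 0 and 1 are separate, as the degree cannot drop by two: there [vdm], respectively each of
   its first derivatives, is constant. *)
have vh := vdm_homog; case E : (\sum_(i < N) i)%N vh => [|[|d]] vh.
- move: vh => /dhomogP h; apply: big1 => i _.
  have -> : vdm = (vdm@_0%MM)%:MP.
    apply/mpolyP => m; rewrite mcoeffC; case: eqVneq => [->|m0]; first by rewrite mulr1.
    rewrite mulr0; apply: memN_msupp_eq0; apply: contra m0 => /h /eqP.
    by rewrite mdeg_eq0.
  by rewrite mderivC mderiv0.
- apply: big1 => i _; have /dhomogP h := mderiv_homog i vh.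
  have -> : mderiv i vdm = ((mderiv i vdm)@_0%MM)%:MP.
    apply/mpolyP => m; rewrite mcoeffC; case: eqVneq => [->|m0]; first by rewrite mulr1.
    rewrite mulr0; apply: memN_msupp_eq0; apply: contra m0 => /h /eqP.
    by rewrite mdeg_eq0.
  by rewrite mderivC.
apply: (@antisym_deg_eq0 _ d); last by rewrite E.
  move=> w; rewrite [LHS](raddf_sum (msym w)) mulr_sumr /=.
  rewrite [RHS](reindex_inj (@perm_inj _ w)) /=; apply: eq_bigr => i _.
  by rewrite !msym_mderiv msym_vdm -signr_odd !mulr_sign; case: odd; rewrite ?mderivN.
by apply: rpred_sum => i _; do 2 apply: mderiv_homog.
Qed.

(** For distinct indices this is [vdm] divided by 'X_i - 'X_j: by antisymmetry the divided
    difference is twice that quotient. *)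
Definition vquot i j : Pol := 2^-1 *: ddiff i j vdm.

Lemma vquotP i j : j != i -> vquot i j * ('X_i - 'X_j) = vdm.
Proof.
move=> ji; rewrite -scalerAl ddiffP // msym_tperm_vdm // opprK -mulr2n -scaler_nat scalerA.
by rewrite mulVf ?scale1r // pnatr_eq0.
Qed.

Lemma vquotC i j : j != i -> vquot j i = - vquot i j.
Proof.
move=> ji; apply: (mulIf (subX_neq0 ji)); rewrite mulNr vquotP //.
by rewrite -opprB mulrN vquotP // eq_sym.
Qed.

(** This is the logarithmic derivative of the product, with denominators cleared by [vquot]. *)
Lemma mderiv_vdm i : mderiv i vdm = \sum_(j | j != i) vquot i j.
Proof.
pose F (p : 'I_N * 'I_N) : Pol := 'X_p.1 - 'X_p.2.
have vF : vdm = \prod_(p <- [seq p : 'I_N * 'I_N <- index_enum _ | (p.1 < p.2)%N]) F p.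
  by rewrite unlock big_filter pair_big_dep.
have lt_neq (p : 'I_N * 'I_N) : (p.1 < p.2)%N -> p.2 != p.1.
  by move=> lt; rewrite -val_eqE neq_ltn lt orbT.
rewrite -[mderiv i vdm]mulr1 {1}vF.
rewrite (@derivation_prod _ (mderiv i) _ _ _ (fun u => vquot u.1 u.2)); first last.
- by move=> p; rewrite mem_filter => /andP[/lt_neq lt _]; rewrite vquotP // -vF mulr1.
- by move=> p; rewrite mem_filter => /andP[/lt_neq lt _]; rewrite subX_neq0.
- exact: mderivM.
- by rewrite -mpolyC1 mderivC.
rewrite big_filter -(pair_big_dep xpredT (fun a b : 'I_N => (a < b)%N)
  (fun a b => mderiv i (F (a, b)) * vquot a b)) /=.
(* The factors with a = i yield the indices j > i; those with b = i yield j < i, where the sign is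
   absorbed by [vquotC]. *)
have dF a b : mderiv i (F (a, b)) * vquot a b =
    (if a == i then vquot a b else 0) + (if b == i then - vquot a b else 0).
  rewrite mderivB !mderivXU; case: eqP => _; case: eqP => _ /=; ring.
under eq_bigr => a _ do (under eq_bigr => b _ do rewrite dF); under eq_bigr do rewrite big_split.
rewrite big_split /= [X in X + _](bigD1 i) //= [X in _ + X + _]big1 ?addr0; last first.
  by move=> a ai; rewrite big1 // => b _; rewrite (negbTE ai).
rewrite eqxx (exchange_big_dep xpredT) //=.
rewrite [X in _ + X](bigD1 i) //= [X in _ + (_ + X)]big1 ?addr0; last first.
  by move=> a ai; rewrite big1 // => b _; rewrite (negbTE ai).
rewrite eqxx [RHS](bigID (fun j : 'I_N => (i < j)%N)) /=; congr (_ + _).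
  by apply: eq_bigl => j; rewrite -val_eqE /=; lia.
apply: eq_big => [j|j ji]; first by rewrite -val_eqE /=; lia.
by rewrite (@vquotC i j) ?opprK // -val_eqE /= neq_ltn ji.
Qed.
End Vandermonde.

(** * The shift k -> k + 1 for S_N *)

Section Transfer.
Context {K : numFieldType} {N : nat}.
Local Notation Pol := {mpoly K[N]}.
Implicit Types (i j l : 'I_N) (p q g : Pol) (w : 'S_N) (O : endo Pol).
Local Notation vdm := (vdm K N).

(** The symmetry clause is what makes the relation stable under composition. *)
Definition transfer O O' := forall g, g \is symmetric ->
  O (vdm * g) = vdm * O' g /\ O' g \is symmetric.

Lemma transferD O1 O1' O2 O2' :
  transfer O1 O1' -> transfer O2 O2' -> transfer (O1 + O2) (O1' + O2').
Proof.
move=> t1 t2 g sg; have [e1 s1] := t1 g sg; have [e2 s2] := t2 g sg.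
by rewrite !endoD e1 e2 mulrDr rpredD.
Qed.

Lemma transferN O O' : transfer O O' -> transfer (- O) (- O').
Proof. by move=> t g sg; have [e s] := t g sg; rewrite !endoN e mulrN rpredN. Qed.

Lemma transferM O1 O1' O2 O2' :
  transfer O1 O1' -> transfer O2 O2' -> transfer (O1 * O2) (O1' * O2').
Proof.
move=> t1 t2 g sg; have [e2 s2] := t2 g sg; have [e1 s1] := t1 _ s2.
by rewrite !endoM e2 e1.
Qed.

Lemma transferMn O O' n : transfer (O *+ n.+1) (O' *+ n.+1) -> transfer O O'.
Proof.
move=> t g sg; have [] := t g sg; rewrite !endoMn mulrnAr => e s.
have n0 : n.+1%:R != 0 :> K by rewrite pnatr_eq0.
split; first by apply: (scalerI n0); rewrite !scaler_nat.
by rewrite -[O' g]scale1r -(mulVf n0) -scalerA scaler_nat rpredZ.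
Qed.

Lemma transfer_mulop p : p \is symmetric -> transfer (mulop p) (mulop p).
Proof. by move=> sp g sg; rewrite /= mulrCA rpredM. Qed.

Lemma transfer_sum_y n :
  transfer (\sum_(i < N) mulop ('X_i : Pol) ^+ n) (\sum_(i < N) mulop ('X_i : Pol) ^+ n).
Proof.
have -> : \sum_(i < N) mulop ('X_i : Pol) ^+ n = mulop (\sum_(i < N) 'X_i ^+ n).
  apply: endoP => p; rewrite endo_sum /= mulr_suml; apply: eq_bigr => i _.
  elim: n => [|n IH]; first by rewrite !expr0 mul1r.
  by rewrite !exprS -mulrA -IH.
apply: transfer_mulop; apply/issymP => w.
rewrite (raddf_sum (msym w)) /= [RHS](reindex_inj (@perm_inj _ w)) /=.
by apply: eq_bigr => i _; rewrite rmorphXn /= msymXU.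
Qed.

Lemma dunklA_sym k i g : g \is symmetric -> dunklA k i g = mderiv i g.
Proof.
move=> /issymP sg; rewrite /= /dunklA_fun big1 ?scaler0 ?addr0 // => j ji.
by rewrite ddiff_sym.
Qed.

Lemma laplacian_sym k g : g \is symmetric ->
  (\sum_(i < N) dunklA k i * dunklA k i) g \is symmetric.
Proof.
move=> /issymP sg; apply/issymP => w; rewrite endo_sum (raddf_sum (msym w)).
rewrite [RHS](reindex_inj (@perm_inj _ w)); apply: eq_bigr => i _.
change (msym w (dunklA k i (dunklA k i g)) = dunklA k (w i) (dunklA k (w i) g)).
by rewrite !msym_dunklA sg.
Qed.

Lemma sum_antisym (F : 'I_N -> 'I_N -> Pol) : (forall i j, j != i -> F j i = - F i j) ->
  \sum_i \sum_(j | j != i) F i j = 0.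
Proof.
move=> FN; have : \sum_i \sum_(j | j != i) F i j = - (\sum_i \sum_(j | j != i) F i j).
  rewrite {1}(exchange_big_dep xpredT) //= -sumrN; apply: eq_bigr => i _.
  by rewrite -sumrN; apply: eq_big => j; rewrite 1?eq_sym // => ij; rewrite FN // eq_sym.
by move/eqP; rewrite -addr_eq0 -mulr2n -mulr_natl mulf_eq0 -mpolyC_nat mpolyC_eq0 pnatr_eq0 => /eqP.
Qed.

Local Notation rho i := (mderiv i vdm).

(** Since g is symmetric, each divided difference of [vdm * g] is 2 g [vquot i j], and these add up
    to twice g times the derivative of [vdm]. *)
Lemma dunklA_vdm_mul k i g : g \is symmetric ->
  dunklA k i (vdm * g) = vdm * mderiv i g + (1 + 2 * k) *: (g * rho i).
Proof.
move=> /issymP sg; rewrite /= /dunklA_fun mderivM.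
rewrite (eq_bigr (fun j => 2 *: (g * vquot i j))); last first.
  move=> j ji; rewrite mulrC ddiffM_sym // /vquot -scalerAr scalerA mulfV ?scale1r //.
  by rewrite pnatr_eq0.
rewrite -scaler_sumr -mulr_sumr -mderiv_vdm -!mul_mpolyC; ring.
Qed.

Lemma ddiff_vdm_mderiv i j g : j != i -> g \is symmetric ->
  ddiff i j (vdm * mderiv i g) = vquot i j * (mderiv i g + mderiv j g).
Proof.
move=> ji /issymP sg; apply: ddiff_eq => //.
rewrite mulrAC vquotP // msymM msym_tperm_vdm // msym_mderiv tpermL sg; ring.
Qed.

Lemma dunklA_mul_sym k i g p : g \is symmetric ->
  dunklA k i (g * p) = mderiv i g * p + g * dunklA k i p.
Proof.
move=> /issymP sg; rewrite /= /dunklA_fun mderivM mulrDr -scalerAr addrA; congr (_ + _ *: _).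
by rewrite mulr_sumr; apply: eq_bigr => j ji; rewrite ddiffM_sym.
Qed.

Lemma dunklA_vdm_mderiv k i g : g \is symmetric ->
  dunklA k i (vdm * mderiv i g) = rho i * mderiv i g + vdm * mderiv i (mderiv i g) +
    k *: \sum_(j | j != i) vquot i j * (mderiv i g + mderiv j g).
Proof.
move=> sg; rewrite /= /dunklA_fun mderivM; congr (_ + _ *: _).
by apply: eq_bigr => j ji; rewrite ddiff_vdm_mderiv.
Qed.

(** The second derivatives cancel because [vdm] is harmonic, and the divided differences because
    they are antisymmetric in i and j. *)
Lemma sum_dunklA_rho k : \sum_i dunklA k i (rho i) = 0.
Proof.
rewrite /= big_split /= vdm_harmonic add0r -scaler_sumr sum_antisym ?scaler0 // => i j ji.
apply: ddiff_eq; first by rewrite eq_sym.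
transitivity (ddiff i j (rho i) * ('X_i - 'X_j)); first by ring.
rewrite (ddiffP _ ji).
rewrite [in LHS]msym_mderiv [in RHS]msym_mderiv.
rewrite tpermC tpermL tpermR.
by rewrite !msym_tperm_vdm // 1?eq_sym // !mderivN !opprK addrC.
Qed.

(** Both sides reduce to [vdm] times the ordinary Laplacian of g plus 2 (k + 1) times the sum of
    [rho i * mderiv i g]. For the parameter k, 2 comes from the product rule and 2 k from the
    divided differences of [vdm * g]; for k + 1 the whole factor comes from divided differences of
    derivatives of g. *)
Lemma transfer_laplacian k :
  transfer (\sum_i dunklA k i * dunklA k i) (\sum_i dunklA (k + 1) i * dunklA (k + 1) i).
Proof.
move=> g sg; split; last exact: laplacian_sym.
have sgP := issymP _ sg; rewrite !endo_sum mulr_sumr.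
have L i : dunklA k i (dunklA k i (vdm * g)) =
  vdm * mderiv i (mderiv i g) + (2 + 2 * k) *: (rho i * mderiv i g) +
  (k *: (\sum_(j | j != i) vquot i j * (mderiv i g + mderiv j g)) +
   (1 + 2 * k) *: (g * dunklA k i (rho i))).
  rewrite dunklA_vdm_mul // efunD efunZ dunklA_vdm_mderiv // dunklA_mul_sym //.
  rewrite -!mul_mpolyC; ring.
have Rr i : vdm * (dunklA (k + 1) i (dunklA (k + 1) i g)) =
  vdm * mderiv i (mderiv i g) + (k + 1) *: (\sum_(j | j != i) vquot i j * (mderiv i g - mderiv j g)).
  rewrite (dunklA_sym _ _ sg) /= /dunklA_fun mulrDr -scalerAr; congr (_ + _ *: _).
  rewrite mulr_sumr; apply: eq_bigr => j ji.
  by rewrite -(vquotP ji) mulrAC -mulrA ddiffP // msym_mderiv tpermL sgP mulrC.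
rewrite (eq_bigr _ (fun i _ => L i)) [RHS](eq_bigr _ (fun i _ => Rr i)).
rewrite !big_split /= -!addrA; congr (_ + _).
rewrite -!scaler_sumr sum_antisym => [|i j ji]; last by rewrite vquotC //; ring.
rewrite -mulr_sumr sum_dunklA_rho mulr0 !scaler0 !addr0.
have -> : \sum_i \sum_(j | j != i) vquot i j * (mderiv i g - mderiv j g) =
  2 *: \sum_i rho i * mderiv i g.
  (* Adding this vanishing sum turns each difference of derivatives of g into twice a single
     derivative. *)
  have e : \sum_i \sum_(j | j != i) vquot i j * (mderiv i g + mderiv j g) = 0.
    by apply: sum_antisym => i j ji; rewrite vquotC //; ring.
  rewrite -[X in X = _]addr0 -[X in _ + X = _]e -big_split /= scaler_sumr.
  apply: eq_bigr => i _; rewrite -big_split /= mderiv_vdm mulr_suml scaler_sumr.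
  by apply: eq_bigr => j ji; rewrite -!mul_mpolyC; ring.
by rewrite scalerA; congr (_ *: _); ring.
Qed.

Definition scal (c : K) : endo Pol := mulop c%:MP.

Lemma scalE c p : scal c p = c *: p.
Proof. by rewrite -mul_mpolyC. Qed.

Lemma scal_central c O : scal c * O = O * scal c.
Proof. by apply: endoP => p; rewrite !endoM !scalE linearZ. Qed.

Lemma transfer_scal c : transfer (scal c) (scal c).
Proof. by move=> g sg; rewrite !scalE scalerAr rpredZ. Qed.

Definition dword k (cs : seq K) i : endo Pol :=
  dunkl_word (dunklA k) (fun i => mulop 'X_i) (map scal cs) i.

Lemma transfer_power_sum k cs n :
  transfer (\sum_i dword k cs i ^+ n.+1) (\sum_i dword (k + 1) cs i ^+ n.+1).
Proof.
apply: (good_power_sum (dunklA_cherednik k) (dunklA_cherednik (k + 1))).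
- exact: transferD.
- exact: transferN.
- exact: transferM.
- exact: transferMn.
- exact: transfer_sum_y.
- exact: transfer_laplacian.
- move=> _ O /mapP[c _ ->]; split; [exact: scal_central | exact: transfer_scal].
Qed.

Lemma dword_comm k cs i j : dword k cs i * dword k cs j = dword k cs j * dword k cs i.
Proof.
apply: (dunkl_word_comm (dunklA_cherednik k)) => _ O /mapP[c _ ->]; exact: scal_central.
Qed.

End Transfer.

(** * Power sums generate the symmetric polynomials *)

Section SymmetricInduction.
Context {K : numFieldType} {N : nat}.
Local Notation Pol := {mpoly K[N]}.
Context (P : Pol -> Prop) (PC : forall c, P c%:MP)
  (PD : forall p q, P p -> P q -> P (p + q))
  (PM : forall p q, P p -> P q -> P (p * q))
  (Ppow : forall n, P (\sum_i 'X_i ^+ n.+1)).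

Let PZ c p : P p -> P (c *: p).
Proof. by move=> Pp; rewrite -mul_mpolyC; apply: PM. Qed.

Let PZ_inv c p : c != 0 -> P (c *: p) -> P p.
Proof. by move=> c0 /(PZ c^-1); rewrite scalerA mulVf // scale1r. Qed.

Let Q : {poly Pol} := \prod_(i < N) ('X - ('X_i)%:P).
Let Qi i : {poly Pol} := \prod_(j < N | j != i) ('X - ('X_j)%:P).

Let Q_factor i : Qi i * ('X - ('X_i)%:P) = Q.
Proof. by rewrite /Q (bigD1 i) //= mulrC. Qed.

Let deriv_Q : Q^`() = \sum_i Qi i.
Proof.
rewrite -[LHS]mulr1 (@derivation_prod _ _ _ _ _ Qi).
- by apply: eq_bigr => i _; rewrite derivXsubC mul1r.
- exact: derivC.
- exact: derivM.
- by move=> i _; rewrite polyXsubC_eq0.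
- by move=> i _; rewrite Q_factor mulr1.
Qed.

(** For b = 0 these are the coefficients of the derivative of [Q]. Raising a and b together splits
    off a coefficient of [Q] times a power sum, until a = N, where the sum vanishes. *)
Let S a b : Pol := \sum_i 'X_i ^+ b * (Qi i)`_a.

Let coef_Q i a : Q`_a.+1 = (Qi i)`_a - 'X_i * (Qi i)`_a.+1.
Proof. by rewrite -(Q_factor i) mulrBr coefB coefMX coefMC /= mulrC. Qed.

Let S_rec a b : S a b = Q`_a.+1 * (\sum_i 'X_i ^+ b) + S a.+1 b.+1.
Proof.
rewrite /S mulr_sumr -big_split /=; apply: eq_bigr => i _.
by rewrite (coef_Q i) exprSr; ring.
Qed.

(* Together with S_rec, this is Newton's identity. *)
Let S_deriv a : S a 0 = Q`_a.+1 *+ a.+1.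
Proof.
rewrite -coef_deriv deriv_Q coef_sum; apply: eq_bigr => i _.
by rewrite expr0 mul1r.
Qed.

Let size_Q : size Q = N.+1.
Proof. by rewrite size_prod_XsubC /index_enum -enumT size_enum_ord. Qed.

Let Q_N : Q`_N = 1.
Proof.
have /monicP : Q \is monic by apply: monic_prod_XsubC.
by rewrite /lead_coef size_Q.
Qed.

Let Psum b : P (\sum_i 'X_i ^+ b).
Proof.
case: b => [|b]; last exact: Ppow.
have -> : \sum_(i < N) 'X_i ^+ 0 = (N%:R)%:MP :> Pol.
  by rewrite sumr_const card_ord mpolyC_nat.
exact: PC.
Qed.

Let PS d a b : (a + d = N)%N -> P (S a b).
Proof.
elim: d a b => [|d IH] a b adN.
  have -> : S a b = 0.
    apply: big1 => i _; rewrite nth_default ?mulr0 //.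
    have := size_Q; rewrite -(Q_factor i) size_Mmonic ?monicXsubC //; last first.
      by apply/prodf_neq0 => j _; rewrite polyXsubC_eq0.
    by rewrite size_XsubC addn2 /= => -[->]; rewrite -adN addn0.
  by rewrite -mpolyC0.
rewrite S_rec; apply: PD; last by apply: IH; rewrite addSnnS.
apply: PM => //; case: d IH adN => [|d] IH adN.
  by rewrite -addn1 adN Q_N -mpolyC1.
(* The coefficient at a + 1 must itself be reached. [S_rec] at b = 0 and [S_deriv] give (a + 1 - N)
   times it as [S a.+1 1], and here a + 1 < N; for a + 1 = N the coefficient is 1. *)
have aN : a.+1%:R - N%:R != 0 :> K by rewrite subr_eq0 eqr_nat; lia.
apply: (PZ_inv aN).
have := S_rec a 0; rewrite S_deriv => e.
have -> : (a.+1%:R - N%:R) *: Q`_a.+1 = S a.+1 1.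
  have -> : S a.+1 1 = Q`_a.+1 *+ a.+1 - Q`_a.+1 * (\sum_(i < N) 'X_i ^+ 0).
    by rewrite e addrC addKr.
  by rewrite sumr_const card_ord scalerBl !scaler_nat mulr_natr.
by apply: IH; rewrite addSnnS.
Qed.

Let PQ a : (a <= N)%N -> P Q`_a.
Proof.
case: (posnP N) => [N0|N_gt0].
  move=> aN; have -> : a = N by lia.
  by rewrite Q_N -mpolyC1; exact: PC.
case: a => [_|a].
  have N0 : N%:R != 0 :> K by rewrite pnatr_eq0 -lt0n.
  apply: (PZ_inv N0).
  (* The constant coefficient of [Q] is -'X_i times that of [Qi i], for each of the N indices i. *)
  have -> : N%:R *: Q`_0 = -1 *: S 0 1.
    rewrite scaleN1r /S -sumrN scaler_nat -[X in _ *+ X](card_ord N) -sumr_const.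
    apply: eq_bigr => i _; rewrite -(Q_factor i) mulrBr coefB coefMX coefMC /=.
    by rewrite expr1; ring.
  by apply: PZ; apply: (PS (d := N)).
rewrite leq_eqVlt => /predU1P[->|aN]; first by rewrite Q_N -mpolyC1.
have n0 : a.+1%:R != 0 :> K by rewrite pnatr_eq0.
apply: (PZ_inv n0); rewrite scaler_nat -S_deriv.
by apply: (PS (d := N - a)); lia.
Qed.

Let Pmesym k : (k <= N)%N -> P (mesym N K k).
Proof.
move=> kN; have kN' : (k < N.+1)%N by [].
have := mroots_coeff [tuple ('X_i : Pol) | i < N] (Ordinal kN').
rewrite big_tuple /=; under eq_bigr do rewrite tnth_mktuple; rewrite -/Q.
have -> : (mesym N Pol k).@[tnth [tuple 'X_i | i < N]] = mesym N K k.
  rewrite /mesym raddf_sum /=; apply: eq_bigr => h _.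
  rewrite rmorph_prod /=; apply: eq_bigr => i _.
  by rewrite mevalXU tnth_mktuple.
move=> e; have -> : mesym N K k = (-1) ^+ k *: Q`_(N - k).
  rewrite e -(signr_odd K) -(signr_odd Pol).
  by case: odd; rewrite ?scaleN1r ?mulN1r ?opprK // scale1r mul1r.
by apply: PZ; apply: PQ; rewrite leq_subr.
Qed.

Lemma symmetric_ind p : p \is symmetric -> P p.
Proof.
move=> /sym_fundamental [t [<- _]]; rewrite comp_mpolyEX.
apply: (big_ind P) => [||m _]; [by rewrite -mpolyC0|exact: PD|].
apply: PZ; rewrite comp_mpolyX; apply: (big_ind P) => [||i _]; [by rewrite -mpolyC1|exact: PM|].
rewrite tnth_mktuple; elim: (m i) => [|n IH]; first by rewrite expr0 -mpolyC1.
by rewrite exprS; apply: PM IH; apply: Pmesym.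
Qed.
End SymmetricInduction.

(** * Symmetric polynomials in the operators A_i *)

Section Evaluation.
Context {K : numFieldType} {N : nat}.
Local Notation Pol := {mpoly K[N]}.

Lemma endo_mpoly_neq0 : (1 : endo Pol) != 0.
Proof.
apply/eqP => /(congr1 (fun f : endo Pol => f 1)); rewrite endo1 endo0 => /eqP.
by rewrite oner_eq0.
Qed.

HB.instance Definition _ := GRing.PzSemiRing_isNonZero.Build (endo Pol) endo_mpoly_neq0.

Lemma scal_additive : additive (@scal K N).
Proof. by move=> c d; apply: endoP => p; rewrite endoD endoN !scalE scalerBl. Qed.

Lemma scal_multiplicative : multiplicative (@scal K N).
Proof.
split=> [c d|]; apply: endoP => p; first by rewrite endoM !scalE scalerA.
by rewrite endo1 scalE scale1r.
Qed.

HB.instance Definition _ := GRing.isAdditive.Build K (endo Pol) (@scal K N) scal_additive.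
HB.instance Definition _ :=
  GRing.isMultiplicative.Build K (endo Pol) (@scal K N) scal_multiplicative.

Section CommutingFamily.
Context (A : 'I_N -> endo Pol) (AC : forall i j, A i * A j = A j * A i).

Local Notation ev := (mmap (@scal K N) A).

Lemma mmap1_comm (a b : 'X_{1..N}) : mmap1 A (a + b) = mmap1 A a * mmap1 A b.
Proof.
rewrite /mmap1; under eq_bigr do rewrite mnmDE exprD.
have cm i (r : seq 'I_N) : GRing.comm (A i ^+ b i) (\prod_(j <- r) A j ^+ a j).
  elim/big_ind: _ => [|x y|j _]; [exact: commr1 | exact: commrM |].
  by apply/commrX/commr_sym/commrX; exact: AC.
elim: (index_enum _) => [|i r IH]; first by rewrite !big_nil mulr1.
rewrite !big_cons IH !mulrA; congr (_ * _).
by rewrite -mulrA cm mulrA.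
Qed.

(** The target ring is noncommutative: multiplicativity rests on [AC] and on the centrality of
    scalars. *)
Lemma ev_mul p q : ev (p * q) = ev p * ev q.
Proof.
elim/mpolyind: p => [|c a p _ _ IH]; first by rewrite mul0r mmap0 mul0r.
rewrite mulrDl !mmapD IH mulrDl; congr (_ + _).
elim/mpolyind: q {IH} => [|d b q _ _ IH]; first by rewrite mulr0 mmap0 mulr0.
rewrite mulrDr !mmapD IH mulrDr; congr (_ + _).
rewrite -scalerAl -scalerAr -mpolyXD !mmapZ !mmapX mmap1_comm.
by rewrite -!mulrA; congr (_ * _); rewrite mulrA scal_central !mulrA.
Qed.

Lemma ev_X i : ev 'X_i = A i.
Proof. by rewrite mmapX mmap1U. Qed.

Lemma ev_power_sum n : ev (\sum_i 'X_i ^+ n) = \sum_i A i ^+ n.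
Proof.
rewrite raddf_sum /=; apply: eq_bigr => i _.
elim: n => [|n IH]; last by rewrite !exprS ev_mul IH ev_X.
by rewrite !expr0 -mpolyC1 mmapC; apply: endoP => p; rewrite scalE scale1r.
Qed.
End CommutingFamily.

(** The scalar [b] will be m^m, the ratio between T_i^m and A_i. *)
Definition cdword (b k : K) cs i : endo Pol := scal b * dword k cs i.

Lemma cdword_exp b k cs i n : cdword b k cs i ^+ n = scal (b ^+ n) * dword k cs i ^+ n.
Proof.
elim: n => [|n IH]; first by apply: endoP => p; rewrite endoM scalE scale1r.
rewrite !exprS IH /cdword.
transitivity (scal b * (dword k cs i * scal (b ^+ n)) * dword k cs i ^+ n); first by rewrite !mulrA.
by rewrite -scal_central; apply: endoP => p; rewrite !endoM !scalE !scalerA.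
Qed.

Lemma cdword_comm b k cs i j :
  cdword b k cs i * cdword b k cs j = cdword b k cs j * cdword b k cs i.
Proof.
have e u v : cdword b k cs u * cdword b k cs v = scal b * scal b * (dword k cs u * dword k cs v).
  rewrite /cdword; transitivity (scal b * (dword k cs u * scal b) * dword k cs v).
     by rewrite !mulrA.
  by rewrite -scal_central !mulrA.
by rewrite !e dword_comm.
Qed.

Lemma transfer_eval b k cs f : f \is symmetric ->
  transfer (mmap (@scal K N) (cdword b k cs) f) (mmap (@scal K N) (cdword b (k + 1) cs) f).
Proof.
apply: (symmetric_ind (P := fun f => transfer (mmap (@scal K N) (cdword b k cs) f)
  (mmap (@scal K N) (cdword b (k + 1) cs) f))) => [c|p q tp tq|p q tp tq|n].
- by rewrite !mmapC; exact: transfer_scal.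
- by rewrite !mmapD; exact: transferD.
- by rewrite !ev_mul; try exact: cdword_comm; exact: transferM.
rewrite !ev_power_sum; try exact: cdword_comm.
have e k' : \sum_(i < N) cdword b k' cs i ^+ n.+1 =
    scal (b ^+ n.+1) * \sum_(i < N) dword k' cs i ^+ n.+1.
  by rewrite mulr_sumr; apply: eq_bigr => i _; rewrite cdword_exp.
by rewrite !e; apply: transferM; [exact: transfer_scal | exact: transfer_power_sum].
Qed.

End Evaluation.

(** * Reduction from G(m,1,N) to S_N *)

Section CyclotomicDunkl.
Context {K : numFieldType} {m N : nat} (z : K).
Implicit Types (kappa : m.-tuple K) (i j : 'I_N) (p f h : {mpoly K[N]}).

(* The operators of Defs with [eta R m] replaced by an arbitrary primitive root z
   of a [numFieldType]; they are convertible to the originals for K := R[i]. *)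
Definition gtau (s : int) i p : {mpoly K[N]} :=
  \sum_(a <- msupp p) (z ^ (s * (a i)%:Z) * p@_a) *: 'X_[a].

Definition greflection (s : nat) i j p : {mpoly K[N]} :=
  gtau (- s%:Z) i (msym (tperm i j) (gtau s%:Z i p)).

Definition gdunkl kappa i p : {mpoly K[N]} :=
  mderiv i p
  + kappa`_0 *: (\sum_(j < N | j != i) \sum_(s < m)
      mquot (p - greflection s i j p) ('X_i - z ^+ s *: 'X_j))
  + \sum_(1 <= t < m) kappa`_t *:
      mquot (\sum_(s < m) z ^ (- (s * t)%N%:Z) *: gtau s%:Z i p) 'X_i.

Definition gdunkl_subst kappa f p : {mpoly K[N]} :=
  \sum_(a <- msupp f)
     f@_a *: foldr (fun i => iter (a i) (gdunkl kappa i)) p (enum 'I_N).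

Definition gin_y f : {mpoly K[N]} :=
  f \mPo [tuple ('X_k : {mpoly K[N]}) ^+ m | k < N].

Hypothesis zp : m.-primitive_root z.

Let m_gt0 : (0 < m)%N := prim_order_gt0 zp.

Let z_neq0 : z != 0.
Proof. by rewrite (prim_root_eq0 zp) -lt0n. Qed.

Let mK_neq0 : m%:R != 0 :> K.
Proof. by rewrite pnatr_eq0 -lt0n. Qed.

Lemma gin_yM f h : gin_y (f * h) = gin_y f * gin_y h. Proof. exact: rmorphM. Qed.
Lemma gin_yD f h : gin_y (f + h) = gin_y f + gin_y h. Proof. exact: rmorphD. Qed.
Lemma gin_yB f h : gin_y (f - h) = gin_y f - gin_y h. Proof. exact: rmorphB. Qed.
Lemma gin_yZ c h : gin_y (c *: h) = c *: gin_y h. Proof. exact: linearZ. Qed.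
Lemma gin_yXU i : gin_y 'X_i = 'X_i ^+ m.
Proof. by rewrite /gin_y comp_mpolyXU -tnth_nth tnth_mktuple. Qed.

Lemma lrmorph_comp (phi : {lrmorphism {mpoly K[N]} -> {mpoly K[N]}}) h
    (t u : N.-tuple {mpoly K[N]}) :
  (forall i, phi (tnth t i) = tnth u i) -> phi (h \mPo t) = h \mPo u.
Proof.
move=> tu; rewrite !comp_mpolyEX (raddf_sum phi) /=; apply: eq_bigr => a _.
rewrite linearZ /= !comp_mpolyX rmorph_prod; congr (_ *: _); apply: eq_bigr => i _.
by rewrite rmorphXn /= tu.
Qed.

Lemma gtau_comp s i p : gtau s i p =
  p \mPo [tuple (if k == i then z ^ s else 1) *: 'X_k | k < N].
Proof.
rewrite comp_mpolyE; apply: eq_bigr => a _.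
under [in RHS]eq_bigr do rewrite tnth_mktuple exprZn.
rewrite scaler_prod -mpolyXE_id scalerA mulrC; congr (_ * _ *: _).
rewrite (bigD1 i)//= eqxx big1 ?mulr1 => [|k /negbTE->]; last by rewrite expr1n.
by rewrite exprnP exprz_exp.
Qed.

Lemma gtauM s i p f : gtau s i (p * f) = gtau s i p * gtau s i f.
Proof. by rewrite !gtau_comp rmorphM. Qed.

Lemma gtauZ s i c p : gtau s i (c *: p) = c *: gtau s i p.
Proof. by rewrite !gtau_comp linearZ. Qed.

Lemma gtau_X s i k n : gtau s i ('X_k ^+ n) = (if k == i then z ^ (s * n%:Z) else 1) *: 'X_k ^+ n.
Proof.
rewrite gtau_comp rmorphXn /= comp_mpolyXU -tnth_nth tnth_mktuple exprZn.
by case: eqP => _; rewrite ?expr1n // exprnP exprz_exp.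
Qed.

Lemma gtau_in_y s i h : gtau s i (gin_y h) = gin_y h.
Proof.
rewrite gtau_comp; apply: lrmorph_comp => k; rewrite !tnth_mktuple.
transitivity (gtau s i ('X_k ^+ m)); first by rewrite gtau_comp.
rewrite gtau_X.
case: eqP => _; rewrite ?scale1r // mulrC -exprz_exp -exprnP (prim_expr_order zp).
by rewrite exp1rz scale1r.
Qed.

Lemma msym_comp w h : msym w h = h \mPo [tuple 'X_(w k) | k < N].
Proof.
by apply: eq_bigr => a _; congr (_ * _); apply: mmap1_eq => k; rewrite tnth_mktuple.
Qed.

Lemma msym_in_y w h : msym w (gin_y h) = gin_y (msym w h).
Proof.
transitivity (h \mPo [tuple ('X_(w k) : {mpoly K[N]}) ^+ m | k < N]).
  by apply: lrmorph_comp => k; rewrite !tnth_mktuple rmorphXn /= msymXU.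
rewrite msym_comp; apply/esym/lrmorph_comp => k.
by rewrite !tnth_mktuple; exact: gin_yXU.
Qed.

Lemma mderivXn i k n : mderiv i ('X_k ^+ n) = ((k == i)%:R * n%:R) *: 'X_k ^+ n.-1 :> {mpoly K[N]}.
Proof.
elim: n => [|n IH]; first by rewrite expr0 -mpolyC1 mderivC mulr0 scale0r.
rewrite exprS mderivM mderivXU IH; case: (k == i); last by rewrite !mul0r !scale0r mulr0 addr0.
rewrite !mul1r; case: n {IH} => [|n] /=; first by rewrite scale0r mulr0 addr0 scale1r.
by rewrite -scalerAr -exprS [n.+2%:R]mulrS scalerDl scale1r.
Qed.

Lemma mderiv_in_y i h : mderiv i (gin_y h) = m%:R *: ('X_i ^+ m.-1 * gin_y (mderiv i h)).
Proof.
pose P h := mderiv i (gin_y h) = m%:R *: ('X_i ^+ m.-1 * gin_y (mderiv i h)).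
have PM f g : P f -> P g -> P (f * g).
  move=> ef eg; rewrite /P gin_yM !mderivM ef eg gin_yD !gin_yM -!mul_mpolyC; ring.
have P1 : P 1.
  by rewrite /P /gin_y rmorph1 -mpolyC1 !mderivC rmorph0 mulr0 scaler0.
have PX k : P 'X_k.
  rewrite /P gin_yXU mderivXn mderivXU; case: eqP => [->|_].
    by rewrite mul1r /gin_y rmorph1 mulr1.
  by rewrite mul0r scale0r /gin_y rmorph0 mulr0 scaler0.
have Pmon (a : 'X_{1..N}) : P 'X_[a].
  rewrite mpolyXE_id; elim/big_ind: _ => [//|u v|k _]; first exact: PM.
  elim: (a k) => [|n IH]; first by rewrite expr0.
  by rewrite exprS; apply: PM IH; exact: PX.
elim/mpolyind: h => [|c a p _ _ IH]; first by rewrite mderiv0 /gin_y rmorph0 mderiv0 mulr0 scaler0.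
rewrite gin_yD !mderivD gin_yD IH mulrDr scalerDr; congr (_ + _).
by rewrite gin_yZ !mderivZ gin_yZ Pmon -!mul_mpolyC; ring.
Qed.

Lemma sum_root_of_unity (w : K) : w ^+ m = 1 -> \sum_(s < m) w ^+ s = if w == 1 then m%:R else 0.
Proof.
move=> wm; case: eqVneq => [->|w1].
  by under eq_bigr do rewrite expr1n; rewrite sumr_const card_ord.
have : (w - 1) * (\sum_(s < m) w ^+ s) = 0 by rewrite -subrX1 wm subrr.
by move/eqP; rewrite mulf_eq0 subr_eq0 (negbTE w1) => /eqP.
Qed.


Lemma greflection_in_y s i j r h : j != i ->
  greflection s i j ('X_i ^+ r * gin_y h) = (z ^+ s *: 'X_j) ^+ r * gin_y (msym (tperm i j) h).
Proof.
move=> ji; rewrite /greflection gtauM gtau_in_y gtau_X eqxx -scalerAl msymZ msymM msym_in_y.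
rewrite rmorphXn /= msymXU tpermL gtauZ gtauM gtau_in_y gtau_X (negbTE ji) scale1r.
by rewrite exprZn -scalerAl -PoszM -exprnP exprM.
Qed.

Lemma rootX_neq0 s i j : j != i -> 'X_i - z ^+ s *: 'X_j != 0 :> {mpoly K[N]}.
Proof.
move=> ji; apply/eqP => /(congr1 (fun p => p@_(U_(i)%MM))).
rewrite mcoeffB mcoeffZ !mcoeffXU eqxx (negbTE ji) mulr0 subr0 mcoeff0 => /eqP.
by rewrite oner_eq0.
Qed.

(** With Y = z^s 'X_j one has Y^m = 'X_j^m, so the numerator is a combination of 'X_i^r - Y^r and
    'X_i^m - Y^m. Both are multiples of 'X_i - Y with geometric quotients. *)
Lemma mquot_reflection s i j r h : j != i ->
  mquot ('X_i ^+ r * gin_y h - greflection s i j ('X_i ^+ r * gin_y h)) ('X_i - z ^+ s *: 'X_j) =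
  (\sum_(k < r) 'X_i ^+ (r.-1 - k) * (z ^+ s *: 'X_j) ^+ k) * gin_y h +
  (\sum_(k < m) 'X_i ^+ (m.-1 - k) * (z ^+ s *: 'X_j) ^+ (r + k)) * gin_y (ddiff i j h).
Proof.
move=> ji; rewrite greflection_in_y //; set Y := z ^+ s *: 'X_j.
have Ym : Y ^+ m = 'X_j ^+ m.
  by rewrite exprZn -exprM mulnC exprM (prim_expr_order zp) expr1n scale1r.
have dh : gin_y (msym (tperm i j) h) = gin_y h - gin_y (ddiff i j h) * ('X_i ^+ m - Y ^+ m).
  have := congr1 gin_y (ddiffP h ji).
  by rewrite gin_yM !gin_yB !gin_yXU Ym => ->; ring.
have -> : 'X_i ^+ r * gin_y h - Y ^+ r * gin_y (msym (tperm i j) h) =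
    ('X_i ^+ r - Y ^+ r) * gin_y h + Y ^+ r * gin_y (ddiff i j h) * ('X_i ^+ m - Y ^+ m).
  by rewrite dh; ring.
have -> : \sum_(k < m) 'X_i ^+ (m.-1 - k) * Y ^+ (r + k) =
    Y ^+ r * \sum_(k < m) 'X_i ^+ (m.-1 - k) * Y ^+ k.
  by rewrite mulr_sumr; apply: eq_bigr => k _; rewrite exprD; ring.
rewrite !subrXX -[RHS](mquotK _ (rootX_neq0 s ji)) -/Y; congr mquot; ring.
Qed.

Lemma sum_rootX j n : \sum_(s < m) (z ^+ s *: 'X_j) ^+ n =
  (if (m %| n)%N then m%:R else 0) *: 'X_j ^+ n :> {mpoly K[N]}.
Proof.
under eq_bigr do rewrite exprZn -exprM mulnC exprM.
rewrite -scaler_suml sum_root_of_unity ?(prim_order_dvd zp) //.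
by rewrite -exprM mulnC exprM (prim_expr_order zp) expr1n.
Qed.

Lemma sum_mquot_reflection0 i j h : j != i ->
  \sum_(s < m) mquot (gin_y h - greflection s i j (gin_y h)) ('X_i - z ^+ s *: 'X_j) =
  m%:R *: ('X_i ^+ m.-1 * gin_y (ddiff i j h)).
Proof.
move=> ji; rewrite (eq_bigr (fun s : 'I_m => (\sum_(k < m) 'X_i ^+ (m.-1 - k) *
   (z ^+ s *: 'X_j) ^+ k) * gin_y (ddiff i j h))); last first.
  move=> s _; have := mquot_reflection s 0 h ji; rewrite expr0 mul1r => ->.
  by rewrite big_ord0 mul0r add0r.
rewrite -mulr_suml exchange_big /= scalerAl; congr (_ * _).
under eq_bigr do rewrite -mulr_sumr sum_rootX.
rewrite (bigD1 (Ordinal m_gt0)) //= dvdn0 subn0 expr0 big1 ?addr0 => [|k k0].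
  by rewrite -scalerAr mulr1.
by rewrite gtnNdvd ?scale0r ?mulr0 // lt0n.
Qed.

Lemma sum_mquot_reflection i j r h : j != i -> (0 < r < m)%N ->
  \sum_(s < m) mquot ('X_i ^+ r * gin_y h - greflection s i j ('X_i ^+ r * gin_y h))
    ('X_i - z ^+ s *: 'X_j) = m%:R *: ('X_i ^+ r.-1 * gin_y (h + 'X_j * ddiff i j h)).
Proof.
move=> ji /andP[r0 rm]; rewrite (eq_bigr _ (fun (s : 'I_m) _ => mquot_reflection s r h ji)).
rewrite big_split /= -!mulr_suml.
rewrite [X in X * _ + _]exchange_big [X in _ + X * _]exchange_big /=.
under eq_bigr do rewrite -mulr_sumr sum_rootX.
under [X in _ + X * _]eq_bigr do rewrite -mulr_sumr sum_rootX.
rewrite (bigD1 (Ordinal r0)) //= dvdn0 subn0 expr0 big1 ?addr0 => [|k k0]; last first.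
  by rewrite gtnNdvd ?scale0r ?mulr0 // ?lt0n // (ltn_trans (ltn_ord k)).
(* Only exponents r + k divisible by m survive the sum over s. Since r <= r + k < r + m and 0 < r <
   m, the only one is m, at k = m - r; it yields y_j. *)
have mr : (m - r < m)%N by lia.
rewrite (bigD1 (Ordinal mr)) //= big1 ?addr0 => [|k k0]; last first.
  rewrite ifN ?scale0r ?mulr0 //; apply/negP => /dvdnP[q qE].
  have km := ltn_ord k; move/eqP: k0; apply; apply/val_inj => /=.
  have q1 : q = 1%N by nia.
  by move: qE; rewrite q1; lia.
rewrite subnKC ?dvdnn 1?ltnW //; have -> : (m.-1 - (m - r) = r.-1)%N by lia.
rewrite gin_yD gin_yM gin_yXU -!mul_mpolyC; ring.
Qed.

(** The sum over s is m times the projection onto exponents of 'X_i congruent to t modulo m, so only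
    t = r contributes. *)
Lemma sum_cyclic kappa i r h : (r < m)%N ->
  \sum_(1 <= t < m) kappa`_t *:
      mquot (\sum_(s < m) z ^ (- (s * t)%N%:Z) *: gtau s%:Z i ('X_i ^+ r * gin_y h)) 'X_i =
  if r is r'.+1 then (m%:R * kappa`_r) *: ('X_i ^+ r' * gin_y h) else 0.
Proof.
move=> rm.
have Xi0 : 'X_i != 0 :> {mpoly K[N]}.
  apply/eqP => /(congr1 (fun p => p@_(U_(i)%MM))); rewrite mcoeffXU eqxx mcoeff0 => /eqP.
  by rewrite oner_eq0.
have inner t : (t < m)%N -> \sum_(s < m) z ^ (- (s * t)%N%:Z) *: gtau s%:Z i ('X_i ^+ r * gin_y h) =
    (if t == r then m%:R else 0) *: ('X_i ^+ r * gin_y h).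
  move=> tm; pose w := z ^+ r / z ^+ t.
  rewrite (eq_bigr (fun s : 'I_m => w ^+ s *: ('X_i ^+ r * gin_y h))); last first.
    move=> s _; rewrite gtauM gtau_in_y gtau_X eqxx -scalerAl scalerA; congr (_ *: _).
    rewrite /w expr_div_n -!exprM -exprnN mulrC; congr (_ * _).
      by rewrite -PoszM -exprnP mulnC.
    by rewrite mulnC.
  rewrite -scaler_suml sum_root_of_unity; last first.
    by rewrite /w expr_div_n -!exprM ![(_ * m)%N]mulnC !exprM (prim_expr_order zp) !expr1n divr1.
  have zt0 := expf_neq0 t z_neq0.
  have -> : (w == 1) = (t == r).
    rewrite -(inj_eq (mulIf zt0)) mulfVK // mul1r (eq_prim_root_expr zp).
    by rewrite !modn_small // eq_sym.
  by [].
rewrite (eq_big_nat _ _ (F2 := fun t => if t == r then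
   kappa`_t *: mquot (m%:R *: ('X_i ^+ r * gin_y h)) 'X_i else 0)); last first.
  move=> t /andP[_ tm]; rewrite inner //; case: eqP => // _.
  by rewrite scale0r -[X in mquot X _](mul0r 'X_i) mquotK // scaler0.
case: r rm inner => [|r] rm inner.
  by rewrite big_nat big1 // => t /andP[t0 _]; rewrite gtn_eqF.
rewrite (bigD1_seq r.+1) ?mem_index_iota ?iota_uniq //= eqxx big1 ?addr0 => [|t /negbTE->//].
have -> : m%:R *: ('X_i ^+ r.+1 * gin_y h) = (m%:R *: ('X_i ^+ r * gin_y h)) * 'X_i.
  by rewrite exprS -!mul_mpolyC; ring.
by rewrite mquotK // scalerA mulrC.
Qed.

Lemma gdunkl_in_y kappa i h :
  gdunkl kappa i (gin_y h) = m%:R *: ('X_i ^+ m.-1 * gin_y (dunklA kappa`_0 i h)).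
Proof.
rewrite /gdunkl (eq_bigr _ (fun j ji => sum_mquot_reflection0 h ji)).
have := sum_cyclic kappa i h m_gt0; rewrite expr0 mul1r => ->; rewrite addr0.
rewrite mderiv_in_y /= /dunklA_fun gin_yD gin_yZ -scaler_sumr.
have -> : gin_y (\sum_(j | j != i) ddiff i j h) = \sum_(j | j != i) gin_y (ddiff i j h).
  by rewrite /gin_y raddf_sum.
rewrite -mulr_sumr -!mul_mpolyC; ring.
Qed.

Definition eigshift kappa r : K := r%:R / m%:R - 1 + kappa`_r.

(** Each application lowers the power of 'X_i by one and leaves a factor U_r-free of 'X_i, namely
    D_i y_i plus a constant. There r/m comes from differentiating 'X_i^r, [kappa_r] from the cyclic
    part, and -1 offsets the extra h in D_i y_i h. *)
Lemma gdunkl_Xin_y kappa i r h : (0 < r < m)%N ->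
  gdunkl kappa i ('X_i ^+ r * gin_y h) =
  m%:R *: ('X_i ^+ r.-1 * gin_y (dunklA kappa`_0 i ('X_i * h) + eigshift kappa r *: h)).
Proof.
move=> rm; have /andP[r0 rltm] := rm.
rewrite /gdunkl (eq_bigr _ (fun j ji => sum_mquot_reflection h ji rm)).
rewrite (sum_cyclic kappa i h rltm) mderivM mderivXn eqxx mul1r mderiv_in_y.
have -> : dunklA kappa`_0 i ('X_i * h) =
    h + 'X_i * mderiv i h + kappa`_0 *: \sum_(j | j != i) (h + 'X_j * ddiff i j h).
  rewrite /= /dunklA_fun mderivM mderivXU eqxx mul1r; congr (_ + _ *: _).
  apply: eq_bigr => j ji; rewrite ddiffXl //.
  by have -> : msym (tperm i j) h = h - ddiff i j h * ('X_i - 'X_j); [rewrite ddiffP //|]; ring.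
case: r r0 rm rltm => // r _ _ rm.
rewrite -scaler_sumr -mulr_sumr !gin_yD !gin_yZ gin_yM gin_yXU.
have -> : gin_y (\sum_(j | j != i) (h + 'X_j * ddiff i j h)) =
    \sum_(j | j != i) gin_y (h + 'X_j * ddiff i j h).
  by rewrite /gin_y raddf_sum.
have -> : r.+1.-1 = r by [].
have -> : 'X_i ^+ r.+1 * (m%:R *: ('X_i ^+ m.-1 * gin_y (mderiv i h))) =
    m%:R *: ('X_i ^+ r * ('X_i ^+ m * gin_y (mderiv i h))).
  have -> : 'X_i ^+ m = 'X_i * 'X_i ^+ m.-1 :> {mpoly K[N]} by rewrite -exprS prednK.
  by rewrite exprS -!mul_mpolyC; ring.
have rE : r.+1%:R = m%:R * (eigshift kappa r.+1 - kappa`_r.+1 + 1) :> K.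
  by rewrite /eigshift addrK subrK mulrC mulfVK.
rewrite rE -!mul_mpolyC !(mpolyCM, mpolyCD, mpolyCB, mpolyC1); ring.
Qed.

Definition eigshifts kappa : seq K := [seq eigshift kappa r | r <- iota 1 m.-1].

Lemma iter_gdunkl kappa i n h : (n < m)%N ->
  iter n (gdunkl kappa i) ('X_i ^+ n * gin_y h) =
  gin_y (m%:R ^+ n *: (\prod_(c <- [seq scal (eigshift kappa r) | r <- iota 1 n])
    (dunklA kappa`_0 i * mulop 'X_i + c)) h).
Proof.
elim: n h => [|n IH] h nm; first by rewrite big_nil !expr0 mul1r scale1r.
rewrite iterSr gdunkl_Xin_y ?nm // -[n.+1.-1]/n scalerAr -gin_yZ IH ?(ltnW nm) //.
rewrite -(addn1 n) iotaD map_cat big_cat /= big_seq1 add1n; congr gin_y.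
by rewrite efunZ scalerA exprD expr1 endoD scalE addn1.
Qed.

(** The first application produces D_i and the power 'X_i^(m-1); the other m - 1 remove that power,
    each leaving one factor U_i + c_r. *)
Lemma iter_m_gdunkl kappa i h :
  iter m (gdunkl kappa i) (gin_y h) =
  gin_y (cdword (m%:R ^+ m) kappa`_0 (eigshifts kappa) i h).
Proof.
rewrite -{1}(prednK m_gt0) iterSr gdunkl_in_y scalerAr -gin_yZ iter_gdunkl ?prednK //.
congr gin_y; rewrite /cdword endoM scalE /dword /dunkl_word endoM /eigshifts -map_comp.
by rewrite efunZ scalerA -exprSr prednK.
Qed.

Lemma iter_mul_gdunkl kappa i h n :
  iter (m * n) (gdunkl kappa i) (gin_y h) =
  gin_y ((cdword (m%:R ^+ m) kappa`_0 (eigshifts kappa) i ^+ n) h).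
Proof.
by rewrite mulnC; elim: n => // n IH; rewrite mulSn iterD IH iter_m_gdunkl exprS.
Qed.

Lemma foldr_gdunkl kappa (a : 'I_N -> nat) h (r : seq 'I_N) :
  foldr (fun i => iter (m * a i) (gdunkl kappa i)) (gin_y h) r =
  gin_y ((\prod_(i <- r) cdword (m%:R ^+ m) kappa`_0 (eigshifts kappa) i ^+ a i) h).
Proof.
elim: r => [|i r IH] /=; first by rewrite big_nil.
by rewrite big_cons IH iter_mul_gdunkl.
Qed.

Lemma gdunkl_subst_in_y kappa f h :
  gdunkl_subst kappa (gin_y f) (gin_y h) =
  gin_y (mmap (@scal K N) (cdword (m%:R ^+ m) kappa`_0 (eigshifts kappa)) f h).
Proof.
(* Passing to y multiplies exponents by m. This is injective, so monomials stay distinct and keep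
   their coefficients. *)
pose mm (a : 'X_{1..N}) : 'X_{1..N} := [multinom (m * a i)%N | i < N].
have mm_inj : injective mm.
  move=> a b /mnmP e; apply/mnmP => i; have := e i; rewrite !mnmE => /eqP.
  by rewrite eqn_pmul2l // => /eqP.
have inX a : gin_y 'X_[a] = 'X_[mm a].
  rewrite /gin_y comp_mpolyX [RHS]mpolyXE_id; apply: eq_bigr => i _.
  by rewrite tnth_mktuple mnmE exprM.
have infE : gin_y f = \sum_(a <- msupp f) f@_a *: 'X_[mm a].
  rewrite {1}[f]mpolyE /gin_y raddf_sum /=; apply: eq_bigr => a _.
  by rewrite linearZ /= -/(gin_y _) inX.
have coef a : (gin_y f)@_(mm a) = f@_a.
  rewrite infE [in RHS](mpolyE f) !raddf_sum /=; apply: eq_bigr => b _.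
  by rewrite !mcoeffZ !mcoeffX (inj_eq mm_inj).
have supp : perm_eq (msupp (gin_y f)) (map mm (msupp f)).
  rewrite infE (eq_bigr (fun a => (gin_y f)@_(mm a) *: 'X_[mm a])) => [|a _]; last by rewrite coef.
  rewrite -(big_map mm xpredT (fun b => (gin_y f)@_b *: 'X_[b])).
  apply: msupp_sumX; first by rewrite map_inj_uniq ?msupp_uniq.
  by move=> _ /mapP[a af ->]; rewrite coef -mcoeff_msupp.
rewrite /gdunkl_subst (perm_big _ supp) big_map /mmap endo_sum.
have gsum (F : 'X_{1..N} -> {mpoly K[N]}) (r : seq 'X_{1..N}) :
    gin_y (\sum_(a <- r) F a) = \sum_(a <- r) gin_y (F a) by rewrite /gin_y raddf_sum.
rewrite gsum; apply: eq_bigr => a _; rewrite coef endoM scalE gin_yZ; congr (_ *: _).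
rewrite /mmap1 -[index_enum _]enumT -foldr_gdunkl.
by elim: (enum _) => //= i r ->; rewrite mnmE.
Qed.

Lemma gdunkl_shift kappa kappa' f g : f \is symmetric -> g \is symmetric ->
  kappa'`_0 = kappa`_0 + 1 -> (forall r, (0 < r < m)%N -> kappa'`_r = kappa`_r) ->
  gdunkl_subst kappa (gin_y f) (gin_y (vdm K N) * gin_y g) =
  gin_y (vdm K N) * gdunkl_subst kappa' (gin_y f) (gin_y g).
Proof.
move=> sf sg k0 kr; rewrite -gin_yM !gdunkl_subst_in_y -gin_yM; congr gin_y.
(* The constants c_r only involve indices 1 to m - 1, where the parameters agree. *)
have -> : eigshifts kappa' = eigshifts kappa.
  apply/eq_in_map => r; rewrite mem_iota add1n prednK // => rm.
  by rewrite /eigshift kr.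
rewrite k0; exact: (proj1 (transfer_eval _ _ _ sf sg)).
Qed.

End CyclotomicDunkl.

Theorem proposition3p26 (R : realType) (m N : nat) (hm : (2 <= m)%N)
    (hN : (1 <= N)%N) (kappa : m.-tuple R[i]%C) (f g : {mpoly R[i]%C[N]})
    (hf : f \is symmetric) (hg : g \is symmetric) :
  dunkl_subst kappa (in_y m f) (in_y m (a_delta R N) * in_y m g) =
  in_y m (a_delta R N) *
    dunkl_subst (shift0 kappa) (in_y m f) (in_y m g).
Proof.
have m_gt0 : (0 < m)%N by apply: leq_trans hm.
have k0 : (shift0 kappa)`_0 = kappa`_0 + 1.
  by rewrite -(tnth_nth 0 _ (Ordinal m_gt0)) tnth_mktuple eqxx.
have kr r : (0 < r < m)%N -> (shift0 kappa)`_r = kappa`_r.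
  case/andP=> r0 rm; rewrite -(tnth_nth 0 _ (Ordinal rm)) tnth_mktuple /=.
  by rewrite gtn_eqF // GRing.addr0.
have := gdunkl_shift (eta_prim R m_gt0) hf hg k0 kr.
(* Once unlocked, [vdm] is convertible to [a_delta], as are the operators for z = [eta R m] to the
   original ones. *)
rewrite unlock.
exact.
Qed.
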